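(* Let $\mathcal{R}$ be the class of reflexive Banach spaces with an unconditional asymptotic structure. For $Y\in\mathcal{R}$, $Y$ is asymptotically uniformly convexifiable if and only if $\sup_{k\in\mathbb{N}}c_Y(D_k^\omega)=\infty$. More precisely, $(D_k^\omega)_{k\in\mathbb{N}}$ is a uniformly characterizing sequence for the class of asymptotically uniformly convexifiable spaces within $\mathcal{R}$, that is: (1) if $Y\in\mathcal{R}$ is asymptotically uniformly convexifiable, then $\sup_{k\in\mathbb{N}}c_Y(D_k^\omega)=\infty$; (2) $\sup_Y\sup_{k\in\mathbb{N}}c_Y(D_k^\omega)<\infty$, where the outer supremum is over all $Y\in\mathcal{R}$ that are not asymptotically uniformly convexifiable.
   Context: Distortion: for metric spaces $(X,d_X)$, $(Y,d_Y)$, $c_Y(X)$ is the infimum of all $D\ge 1$ for which there are $s>0$ and $f\colon X\to Y$ with $s\,d_X(x,y)\le d_Y(f(x),f(y))\le D s\,d_X(x,y)$ for all $x,y\in X$ (and $c_Y(X)=\infty$ if there is none). Countably branching diamond graphs: $D_0^\omega$ is the graph with two vertices joined by an edge. For $k\ge 0$, $D_{k+1}^\omega$ is obtained from $D_k^\omega$ by removing each edge $\{u,v\}$ and adding instead a countably infinite set of new vertices (disjoint sets for distinct edges), each joined by an edge to $u$ and to $v$ and to nothing else. The metric space $D_k^\omega$ is its vertex set with the shortest path metric, edges having length one. $\mathrm{cof}(Y)$ denotes the set of (closed) finite-codimensional subspaces of $Y$, $S_Z$ the unit sphere of $Z$. Unconditional asymptotic structure: a finite sequence $(x_j)_{j=1}^n$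 is $C$-unconditional if $\|\sum_j\epsilon_j a_jx_j\|\le C\|\sum_j a_jx_j\|$ for all scalars $a_j$ and signs $\epsilon_j=\pm1$. $Y$ has an unconditional asymptotic structure if there is $C\ge1$ such that for all $n\in\mathbb{N}$: $\exists Y_1\in\mathrm{cof}(Y)\ \forall x_1\in S_{Y_1}\ \ldots\ \exists Y_n\in\mathrm{cof}(Y)\ \forall x_n\in S_{Y_n}$, $(x_j)_{j=1}^n$ is $C$-unconditional. Asymptotic uniform convexity: the norm of $Y$ is asymptotically uniformly convex if $\bar\delta_Y(t):=\inf_{y\in S_Y}\sup_{Z\in\mathrm{cof}(Y)}\inf_{z\in S_Z}\|y+tz\|-1>0$ for every $t\in(0,1)$. $Y$ is asymptotically uniformly convexifiable if it admits an equivalent asymptotically uniformly convex norm. *)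

(* Defs.v *)
From HB Require Import structures.
From mathcomp Require Import all_boot all_order all_algebra.
From mathcomp Require Import all_classical all_reals all_analysis.

Set Implicit Arguments.
Unset Strict Implicit.
Unset Printing Implicit Defensive.

Import Order.TTheory GRing.Theory Num.Theory.
Import numFieldNormedType.Exports.

Local Open Scope classical_set_scope.
Local Open Scope ring_scope.

(* An edge [e] joins the two vertices listed in [ends e]. The order in this pair
   is an artefact of the encoding: edges are undirected (see [adjacent]). *)
Record graph := Graph {
  vertex : Type;
  edge : Type;
  ends : edge -> vertex * vertex }.

Definition adjacent (G : graph) (u v : vertex G) : Prop :=
  exists e : edge G, ends e = (u, v) \/ ends e = (v, u).

Inductive walk (G : graph) (u : vertex G) : nat -> vertex G -> Prop :=
| walk_nil : walk u 0 u
| walk_rcons n v w : walk u n v -> adjacent v w -> walk u n.+1 w.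

(* The real infimum of the empty set is 0, so this is the path distance only on
   connected graphs; see [diamond_connected]. *)
Definition path_dist (R : realType) (G : graph) (u v : vertex G) : R :=
  inf [set n%:R | n in [set n | walk u n v]].

Definition single_edge : graph := @Graph bool unit (fun=> (false, true)).

(* [inr (e, n)] is the [n]-th new vertex put in place of the old edge [e]; the
   edge [(e, n, b)] joins it to the first ([b = false]) or to the second
   ([b = true]) end of [e]. *)
Definition subdivide (G : graph) : graph :=
  @Graph (vertex G + edge G * nat) (edge G * nat * bool)
    (fun enb : edge G * nat * bool =>
       let: (e, n, b) := enb in
       (inl (if b then (ends e).2 else (ends e).1), inr (e, n))).

Definition diamond (k : nat) : graph := iter k subdivide single_edge.

Section connectedness.
Variable G : graph.
Implicit Types u v w : vertex G.

Lemma adjacent_sym u v : adjacent u v -> adjacent v u.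
Proof. by case=> e [] h; exists e; [right|left]. Qed.

Lemma walk_trans m n u v w : walk u m v -> walk v n w -> walk u (m + n) w.
Proof.
move=> uv; elim=> [|l x y _ IH xy]; first by rewrite addn0.
by rewrite addnS; apply: walk_rcons IH xy.
Qed.

Lemma walk_sym n u v : walk u n v -> walk v n u.
Proof.
elim=> [|l x y _ IH xy]; first exact: walk_nil.
rewrite -add1n; apply: walk_trans IH.
exact/(walk_rcons (walk_nil _))/adjacent_sym.
Qed.

End connectedness.

Lemma diamond_connected k (u v : vertex (diamond k)) : exists n, walk u n v.
Proof.
elim: k u v => [|k IH].
  case=> - []; try by exists 0; exact: walk_nil.
  - by exists 1; apply: walk_rcons (walk_nil _) _; exists tt; right.
  - by exists 1; apply: walk_rcons (walk_nil _) _; exists tt; left.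
move: IH; rewrite /diamond iterS; move: (iter k _ _) => G IH.
have near_old (u : vertex (subdivide G)) :
    exists (w : vertex G) (n : nat), walk u n (inl w : vertex (subdivide G)).
  case: u => [w|[e n]]; first by exists w, 0; exact: walk_nil.
  exists (ends e).1, 1; apply: walk_rcons (walk_nil _) _.
  by exists (e, n, false); right.
have old_old (w w' : vertex G) : exists n,
    walk (inl w : vertex (subdivide G)) n (inl w' : vertex (subdivide G)).
  have [m] := IH w w'; elim=> [|l x y _ [n wx] [e exy]].
    by exists 0; exact: walk_nil.
  exists n.+2.
  have [b [b1 b2]] : exists b, x = (if b then (ends e).2 else (ends e).1) /\
                               y = (if ~~ b then (ends e).2 else (ends e).1).
    by case: exy => ->; [exists false|exists true].
  apply: (@walk_rcons (subdivide G) _ _ (inr (e, 0))).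
    by apply: walk_rcons wx _; exists (e, 0, b); left; rewrite b1.
  by exists (e, 0, ~~ b); right; rewrite b2.
move=> u v; have [w [m uw]] := near_old u; have [w' [n vw']] := near_old v.
have [l ww'] := old_old w w'; exists (m + l + n)%N.
exact: walk_trans (walk_trans uw ww') (walk_sym vw').
Qed.

Definition distortion (R : realType) (X Y : Type)
    (dX : X -> X -> R) (dY : Y -> Y -> R) : \bar R :=
  ereal_inf [set D%:E | D in [set D : R | 1 <= D /\
    exists (s : R) (f : X -> Y), 0 < s /\
      forall x y, s * dX x y <= dY (f x) (f y) <= D * s * dX x y]].

Definition diamond_distortion (R : realType) (Y : normedModType R) (k : nat)
    : \bar R :=
  distortion (@path_dist R (diamond k)) (fun x y : Y => `|x - y|).

Section banach.
Variables (R : realType) (Y : completeNormedModType R).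

Definition dual (f : Y -> R) : Prop := scalar f /\ continuous f.

Definition dual_norm (f : Y -> R) : R :=
  sup [set `|f x| | x in [set x : Y | `|x| <= 1]].

(* The elements of the bidual are represented by arbitrary functions on
   [Y -> R], of which only the values on the dual matter. *)
Definition bidual (F : (Y -> R) -> R) : Prop :=
  (forall (a : R) (f g : Y -> R), dual f -> dual g ->
     F (fun x => a * f x + g x) = a * F f + F g) /\
  (exists M : R, forall f, dual f -> `|F f| <= M * dual_norm f).

Definition reflexive_space : Prop :=
  forall F, bidual F -> exists y : Y, forall f, dual f -> F f = f y.

Definition finite_codim (Z : set Y) : Prop :=
  exists (n : nat) (v : 'I_n -> Y),
    forall y, exists a : 'I_n -> R, Z (y - \sum_(i < n) a i *: v i).

Definition cof : set (set Y) :=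
  [set Z | [/\ submod_closed (mem Z), closed Z & finite_codim Z]].

Definition unconditional (C : R) (s : seq Y) : Prop :=
  forall (a : nat -> R) (eps : nat -> bool),
    `| \sum_(j < size s) ((-1) ^+ eps j * a j) *: s`_j |
      <= C * `| \sum_(j < size s) a j *: s`_j |.

(* exists Y_1 in cof(Y), forall x_1 in S_{Y_1}, ...,
   exists Y_n in cof(Y), forall x_n in S_{Y_n}, P [:: x_1; ...; x_n] *)
Fixpoint asymptotically (n : nat) (P : seq Y -> Prop) : Prop :=
  if n is m.+1 then
    exists2 Z, cof Z & forall x, Z x -> `|x| = 1 ->
      asymptotically m (fun s => P (x :: s))
  else P [::].

Definition unconditional_asymptotic_structure : Prop :=
  exists C : R, 1 <= C /\ forall n, asymptotically n (unconditional C).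

Definition equivalent_norm (N : Y -> R) : Prop :=
  [/\ forall x y, N (x + y) <= N x + N y,
      forall (a : R) x, N (a *: x) = `|a| * N x
    & exists c C : R, [/\ 0 < c, 0 < C
        & forall x, c * `|x| <= N x <= C * `|x| ] ].

(* Infima and suprema are taken in the extended reals, so that the infimum over
   an empty sphere is [+oo]. An equivalent norm has the same closed subspaces,
   so [cof] does not depend on [N]. *)
Definition auc_modulus (N : Y -> R) (t : R) : \bar R :=
  ereal_inf [set
    ereal_sup [set
      ereal_inf [set (N (y + t *: z) - 1)%:E | z in [set z | Z z /\ N z = 1]]
    | Z in cof]
  | y in [set y | N y = 1]].

Definition asymptotically_uniformly_convex (N : Y -> R) : Prop :=
  forall t : R, 0 < t < 1 -> (0 < auc_modulus N t)%E.

Definition auc_convexifiable : Prop :=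
  exists2 N, equivalent_norm N & asymptotically_uniformly_convex N.

Definition reflexive_unconditional : Prop :=
  reflexive_space /\ unconditional_asymptotic_structure.

Definition sup_diamond_distortion : \bar R :=
  ereal_sup (range (diamond_distortion Y)).

End banach.

(* Main.v *)
(* If Y has an asymptotically uniformly convex norm N and f embeds the (k+1)-st
   diamond graph into Y, then the images of the infinitely many common neighbours
   of u and v are well separated, hence cannot all be almost midpoints of f u and
   f v: two of them differ almost by a vector of a finite-codimensional subspace,
   in which direction N grows. So N (f u - f v) is smaller than twice the Lipschitz
   constant by a fixed factor, and f restricted to the k-th diamond graph has a
   smaller distortion. Iterating, the distortions are unbounded.

   Conversely, suppose that in the dual, for every tau > 0, some n and some choice
   of successive weak* neighbourhoods force `|f_1 + ... + f_n| <= tau n for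
   functionals f_i of norm at most 1. Averaging the values of the games of length
   m < n gives a convex function on the dual whose unit ball polarizes to a norm on
   Y that grows asymptotically at scale t = 24 tau, and a weighted sum of such
   norms is asymptotically uniformly convex. Otherwise there are weakly null trees
   of functionals with norm greater than tau n along all branches; in a reflexive
   space, weak limits of vectors norming the branches give weakly null trees of
   vectors with bounded sums, many terms of which are not small. Unconditionality
   makes all their signed partial sums bounded, and James' blocking argument
   improves the bound to 3/2, so that it depends neither on tau nor on the
   unconditionality constant. In such a tree, thinned out to be biorthogonal to
   functionals of norm at most 3, the diamonds embed with distortion 27/2 by
   sending each new vertex to the midpoint of its neighbours plus a tree vector.
   Coordinates see the height and the distance to the vertex where two points
   separate, which together control the path distance. *)
From Pilot Require Import Defs.
From mathcomp Require Import all_boot all_order all_algebra.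
From mathcomp Require Import all_classical all_reals all_analysis.
From mathcomp Require Import lra zify.

Set Implicit Arguments.
Unset Strict Implicit.
Unset Printing Implicit Defensive.

Import Order.TTheory GRing.Theory Num.Theory.
Import numFieldNormedType.Exports.
(* Restores [adjacent], which mathcomp-analysis also defines. *)
Import Pilot.Defs.

Local Open Scope classical_set_scope.
Local Open Scope ring_scope.

(** * Elementary real estimates *)

Lemma inf_le_approx (R : realType) (E : set R) (a : R) : has_lbound E ->
  (forall e, 0 < e -> exists2 x, E x & x <= a + e) -> inf E <= a.
Proof.
move=> lbE Ea; apply/ler_addgt0Pr => e /Ea[x Ex xa].
exact: le_trans (ge_inf lbE Ex) xa.
Qed.

Lemma bernoulli (R : realType) (x : R) n : 0 <= x -> 1 + n%:R * x <= (1 + x) ^+ n.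
Proof.
move=> x0; elim: n => [|n IH]; first by rewrite expr0 mul0r addr0.
rewrite exprS -[n.+1%:R]natr1; have n0 : 0 <= n%:R :> R by [].
have x10 : 0 <= 1 + x by lra.
have := ler_wpM2l x10 IH; have : 0 <= x * (n%:R * x) by rewrite !mulr_ge0.
lra.
Qed.

(** * The Hahn-Banach theorem *)

Section hahn_banach.
Variables (R : realType) (V : lmodType R).
Implicit Types (p q f : V -> R) (x y v w : V).

Definition sublinear p : Prop :=
  (forall x y, p (x + y) <= p x + p y) /\
  (forall a x, 0 <= a -> p (a *: x) = a * p x).

Lemma sublinear0 p : sublinear p -> p 0 = 0.
Proof. by move=> [_ pZ]; rewrite -[X in p X](scale0r 0) pZ// mul0r. Qed.

Lemma sublinearN p x : sublinear p -> - p (- x) <= p x.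
Proof.
move=> p_sub; rewrite lerNl -subr_ge0 opprK -(sublinear0 p_sub).
by rewrite -[X in p X](addNr x); case: p_sub => + _; apply.
Qed.

Lemma sublinear_ge p x y : sublinear p -> p x - p (- y) <= p (x + y).
Proof. by move=> [pD _]; rewrite lerBlDr (le_trans _ (pD _ _))// addrK. Qed.

Let ray p w x := [set p (x + t *: w) - t * p w | t in [set t : R | 0 <= t]].

(* The largest sublinear functional below [p] whose value at [- w] is at most
   [- p w]. *)
Definition lower p w x := inf (ray p w x).

Let ray_lbound p w x : sublinear p -> lbound (ray p w x) (- p (- x)).
Proof.
move=> p_sub _ [t t0 <-]; have := sublinear_ge (t *: w) (- x) p_sub.
case: (p_sub) => pD pZ; rewrite opprK pZ//.
have := pD (x + t *: w) (- x); rewrite addrAC subrr add0r pZ//.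
lra.
Qed.

Lemma lower_le_ray p w x t : sublinear p -> 0 <= t ->
  lower p w x <= p (x + t *: w) - t * p w.
Proof.
move=> p_sub t0; apply: ge_inf; last by exists t.
exists (- p (- x)); exact: ray_lbound.
Qed.

Lemma lower_le p w x : sublinear p -> lower p w x <= p x.
Proof.
by move=> /(@lower_le_ray p w x 0) /(_ (lexx _)); rewrite scale0r addr0 mul0r subr0.
Qed.

Let lower_approx p w x e : sublinear p -> 0 < e -> exists t,
  0 <= t /\ p (x + t *: w) - t * p w < lower p w x + e.
Proof.
move=> p_sub e0; have [|_ [t t0 <-] H] := @inf_adherent _ (ray p w x) e e0.
- split; first by exists (p (x + 0 *: w) - 0 * p w), 0 => //=.
  exists (- p (- x)); exact: ray_lbound.
- by exists t.
Qed.

Lemma lower_sublinear p w : sublinear p -> sublinear (lower p w).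
Proof.
move=> p_sub; have [pD pZ] := p_sub; split.
  move=> x y; apply: inf_le_approx.
    exists (- p (- (x + y))); exact: ray_lbound.
  move=> e e0; have e20 : 0 < e / 2 by rewrite divr_gt0.
  have [t [t0 Ht]] := lower_approx w x p_sub e20.
  have [s [s0 Hs]] := lower_approx w y p_sub e20.
  exists (p (x + y + (t + s) *: w) - (t + s) * p w).
    by exists (t + s) => //=; rewrite addr_ge0.
  have := pD (x + t *: w) (y + s *: w).
  by rewrite scalerDl addrACA; lra.
move=> a x; rewrite le_eqVlt => /predU1P[<-|a0].
  rewrite scale0r mul0r; apply/eqP; rewrite eq_le; apply/andP; split.
    by apply: le_trans (lower_le w 0 p_sub) _; rewrite sublinear0.
  apply: lb_le_inf; first by exists (p (0 + 0 *: w) - 0 * p w), 0 => //=.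
  by move=> z /(ray_lbound p_sub); rewrite oppr0 sublinear0// oppr0.
have le_scale b u : 0 < b -> lower p w (b *: u) <= b * lower p w u.
  move=> b0; apply: inf_le_approx.
    exists (- p (- (b *: u))); exact: ray_lbound.
  move=> e e0; have [t [t0 Ht]] := lower_approx w u p_sub (divr_gt0 e0 b0).
  exists (p (b *: u + (b * t) *: w) - (b * t) * p w).
    by exists (b * t) => //=; rewrite mulr_ge0// ltW.
  rewrite -scalerA -scalerDr pZ ?(ltW b0)// -mulrA -mulrBr.
  have := ltW Ht; rewrite -(ler_pM2l b0) [leRHS]mulrDr => /le_trans; apply.
  by rewrite mulrCA divff ?mulr1// gt_eqF.
apply/eqP; rewrite eq_le le_scale//=.
have := le_scale a^-1 (a *: x); rewrite invr_gt0 => /(_ a0).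
by rewrite scalerK ?gt_eqF// ler_pdivlMl.
Qed.

Let minimal p := forall q, sublinear q -> (forall x, q x <= p x) ->
  forall x, p x <= q x.

(** Minimality forces [p] to lie below [lower p y]; the ray at [t = 1] then gives
    [p x <= p (x + y) - p y], the missing half of additivity. *)
Let minimal_linear p : sublinear p -> minimal p -> scalar p.
Proof.
move=> p_sub p_min; have [pD pZ] := p_sub.
have pDE x y : p (x + y) = p x + p y.
  apply/eqP; rewrite eq_le pD/=.
  have := p_min _ (lower_sublinear y p_sub) (fun=> lower_le _ _ p_sub) x.
  move=> /le_trans /(_ (lower_le_ray y x p_sub (@ler01 _))).
  by rewrite scale1r mul1r; lra.
have pN x : p (- x) = - p x.
  by apply/eqP; rewrite -addr_eq0 -pDE addNr sublinear0.
move=> a x y; rewrite pDE; congr (_ + _).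
have [a0|a0] := lerP 0 a; first by rewrite pZ.
by rewrite -[a]opprK scaleNr pN pZ ?mulNr ?oppr_ge0// ltW.
Qed.

(** Zorn's lemma for the reversed pointwise order. A chain is bounded by its pointwise infimum,
    which is finite because sublinear functionals below [p] are at least [- p (- x)] at [x]. *)
Lemma below_minimal p : sublinear p ->
  exists q, [/\ sublinear q, forall x, q x <= p x & minimal q].
Proof.
move=> p_sub.
pose T := {q : V -> R | sublinear q /\ forall x, q x <= p x}.
pose p0 : T := exist _ p (conj p_sub (fun x => lexx (p x))).
pose rle : rel T := fun s t => `[< forall x, sval t x <= sval s x >].
have [||| t tmax] := @ZL_preorder T p0 rle.
- by move=> t; apply/asboolP.
- by move=> r s t /asboolP rs /asboolP st; apply/asboolP => x; apply: le_trans (rs x).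
- move=> A Atot; have [[t0 At0]|A0] := pselect (A !=set0); last first.
    by exists p0 => s As; case: A0; exists s.
  pose E x := [set sval t x | t in A].
  have lbE x : lbound (E x) (- p (- x)).
    move=> _ [t At <-]; have [ts tp] := svalP t.
    by apply: le_trans (sublinearN x ts); rewrite lerN2.
  have hlbE x : has_lbound (E x) by exists (- p (- x)).
  have approx x e : 0 < e -> exists t, A t /\ sval t x < inf (E x) + e.
    move=> e0; have [|_ [t At <-] H] := @inf_adherent _ (E x) e e0.
    - by split => //; exists (sval t0 x), t0.
    - by exists t.
  pose q x := inf (E x).
  have q_sub : sublinear q.
    split.
      move=> x y; apply: inf_le_approx => // e e0.
      have e20 : 0 < e / 2 by rewrite divr_gt0.
      have [t [At tx]] := approx x _ e20; have [s [As sy]] := approx y _ e20.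
      have [r [Ar rt rs]] : exists r, [/\ A r, sval r x <= sval t x & sval r y <= sval s y].
        case: (Atot t s At As) => /asboolP H; first by exists s; split.
        by exists t; split.
      exists (sval r (x + y)); first by exists r.
      have [[rD _] _] := svalP r; have := rD x y; rewrite /q; lra.
    move=> a x; rewrite le_eqVlt => /predU1P[<-|a0].
      rewrite scale0r mul0r /q (_ : E 0 = [set 0]) ?inf1//.
      apply/seteqP; split => [_ [t At <-]|_ ->] /=.
        by have [ts _] := svalP t; rewrite sublinear0.
      by exists t0 => //; have [ts _] := svalP t0; rewrite sublinear0.
    have le_scale b u : 0 < b -> q (b *: u) <= b * q u.
      move=> b0; apply: inf_le_approx => // e e0.
      have [t [At tu]] := approx u _ (divr_gt0 e0 b0).
      exists (sval t (b *: u)); first by exists t.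
      have [[_ tZ] _] := svalP t; rewrite tZ ?(ltW b0)//.
      have := ltW tu; rewrite -(ler_pM2l b0) [leRHS]mulrDr => /le_trans; apply.
      by rewrite mulrCA divff ?mulr1// gt_eqF.
    apply/eqP; rewrite eq_le le_scale//=.
    have := le_scale a^-1 (a *: x); rewrite invr_gt0 => /(_ a0).
    by rewrite scalerK ?gt_eqF// ler_pdivlMl.
  have q_le t x : A t -> q x <= sval t x by move=> At; apply: ge_inf => //; exists t.
  have qp x : q x <= p x by by apply: le_trans (q_le _ x At0) _; have [_ ->] := svalP t0.
  by exists (exist _ q (conj q_sub qp)) => s As; apply/asboolP => x; apply: q_le.
- have [t_sub tp] := svalP t; exists (sval t); split => // q q_sub qt x.
  have qp y : q y <= p y by apply: le_trans (qt y) _.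
  have /asboolP := tmax (exist _ q (conj q_sub qp)) (asboolT qt); exact.
Qed.

(** A minimal functional below [lower p v] is linear, and the ray at [t = 1] gives
    [f (- v) <= - p v], hence [f v >= p v]. *)
Theorem hahn_banach p v : sublinear p ->
  exists f, [/\ scalar f, forall x, f x <= p x & f v = p v].
Proof.
move=> p_sub; have [f [f_sub fp fmin]] := below_minimal (lower_sublinear v p_sub).
have fl := minimal_linear f_sub fmin.
have fx x : f x <= p x by apply: le_trans (fp x) _; exact: lower_le.
exists f; split => //; apply/eqP; rewrite eq_le fx/=.
have := le_trans (fp (- v)) (lower_le_ray v (- v) p_sub (@ler01 _)).
rewrite scale1r addNr sublinear0// mul1r sub0r -[- v]addr0 -scaleN1r fl.
by rewrite sublinear0// addr0 mulN1r lerN2.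
Qed.

End hahn_banach.

(** * Linear functionals and subspaces *)

Section functionals.
Variables (R : realType) (Y : completeNormedModType R).
Implicit Types (f g : Y -> R) (x y z v w : Y) (Z W : set Y) (s : seq Y).

Definition bounded_scalar (r : R) f : Prop :=
  scalar f /\ forall x, `|f x| <= r * `|x|.

Lemma scalarD f x y : scalar f -> f (x + y) = f x + f y.
Proof. by move=> fl; rewrite -[x]scale1r fl mul1r scale1r. Qed.

Lemma scalar0 f : scalar f -> f 0 = 0.
Proof. by move=> fl; apply: (addrI (f 0)); rewrite -scalarD// !addr0. Qed.

Lemma scalarZ f a x : scalar f -> f (a *: x) = a * f x.
Proof. by move=> fl; rewrite -[a *: x]addr0 fl scalar0// addr0. Qed.

Lemma scalarN f x : scalar f -> f (- x) = - f x.
Proof. by move=> fl; rewrite -scaleN1r scalarZ// mulN1r. Qed.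

Lemma scalarB f x y : scalar f -> f (x - y) = f x - f y.
Proof. by move=> fl; rewrite scalarD// scalarN. Qed.

Lemma scalarE f : scalar f ->
  ((forall x y, f (x + y) = f x + f y)%R * (forall a x, f (a *: x) = a * f x)%R *
   (forall x, f (- x) = - f x)%R * (f 0 = 0)%R)%type.
Proof.
by move=> fl; do !split => *; rewrite ?(scalarD, scalarZ, scalarN, scalar0).
Qed.

Lemma bounded_scalar1_le f x : bounded_scalar 1 f -> f x <= `|x|.
Proof. by move=> [_ fb]; rewrite -[leRHS]mul1r (le_trans (ler_norm _)). Qed.

Lemma bounded_scalar_continuous r f : bounded_scalar r f -> continuous f.
Proof.
move=> [fl fb] x; apply/cvgrPdist_le => e e0.
have r0 : 0 < `|r| + 1 by rewrite ltr_wpDl.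
near=> y; rewrite -scalarB// (le_trans (fb _))//.
have xy : `|x - y| <= e / (`|r| + 1).
  by near: y; apply: cvgr_dist_le; [exact: cvg_id|rewrite divr_gt0].
apply: (@le_trans _ _ ((`|r| + 1) * `|x - y|)).
  by rewrite ler_wpM2r// (le_trans (ler_norm r))// lerDl.
by rewrite mulrC -ler_pdivlMr.
Unshelve. all: by end_near. Qed.

Lemma bounded_scalar_dual r f : bounded_scalar r f -> dual f.
Proof. by move=> fb; split; [case: fb|exact: bounded_scalar_continuous fb]. Qed.

Lemma dual_bounded_scalar f : dual f -> exists r, 0 <= r /\ bounded_scalar r f.
Proof.
move=> [fl fc].
have /cvgrPdist_lt /(_ 1 ltr01) := fc 0; rewrite scalar0//.
move=> /nbhs_normP[d /= d0 H].
have small x : `|x| < d -> `|f x| < 1.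
  by move=> xd; have := H x; rewrite /= !sub0r !normrN; apply.
exists (2 / d); split; first by rewrite divr_ge0// ltW.
split => // x; have [->|x0] := eqVneq x 0; first by rewrite scalar0// !normr0 mulr0.
have nx : 0 < `|x| by rewrite normr_gt0.
have := small ((d / (2 * `|x|)) *: x).
rewrite normrZ ger0_norm ?divr_ge0 ?mulr_ge0 ?(ltW d0)//.
rewrite invfM -!mulrA mulVf ?gt_eqF// mulr1.
have d2 : d / 2 < d by lra.
move=> /(_ d2); rewrite scalarZ// normrM ger0_norm; last first.
  by rewrite !mulr_ge0 ?invr_ge0 ?(ltW d0).
move=> /ltW; rewrite mulrC -ler_pdivlMr ?mulr_gt0 ?invr_gt0//.
by rewrite mul1r !invfM !invrK mulrCA.
Qed.

Lemma norming_functional v : exists f, bounded_scalar 1 f /\ f v = `|v|.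
Proof.
have nsub : sublinear (fun x : Y => `|x|).
  by split => [x y|a x a0]; [exact: ler_normD|rewrite normrZ ger0_norm].
have [f [fl fn fv]] := hahn_banach v nsub.
exists f; split => //; split => // x; rewrite mul1r ler_norml fn andbT.
by rewrite lerNl -scalarN// (le_trans (fn _))// normrN.
Qed.

Lemma eq_functionals x y : (forall f, scalar f -> f x = f y) -> x = y.
Proof.
move=> H; apply/eqP; rewrite -subr_eq0 -normr_eq0.
have [f [[fl _] <-]] := norming_functional (x - y).
by rewrite scalarB// H// subrr.
Qed.

End functionals.

(* Functionals separate points, so that a linear identity between vectors
   reduces to a real one. *)
Ltac vector :=
  let f := fresh "f" in let fl := fresh "fl" in
  apply: eq_functionals => f fl; rewrite ?(scalarE fl); lra.

(** * Distance to a subspace and finite nets modulo a subspace *)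

Section subspaces.
Variables (R : realType) (Y : completeNormedModType R).
Implicit Types (f g : Y -> R) (x y z v w : Y) (Z W : set Y) (s : seq Y).

Definition subspace Z : Prop := Z 0 /\ forall a x y, Z x -> Z y -> Z (a *: x + y).

Lemma subspaceZ Z a x : subspace Z -> Z x -> Z (a *: x).
Proof. by move=> [Z0 ZL] Zx; rewrite -[_ *: _]addr0; apply: ZL. Qed.

Lemma subspaceD Z x y : subspace Z -> Z x -> Z y -> Z (x + y).
Proof. by move=> [_ ZL] Zx Zy; rewrite -[x]scale1r; apply: ZL. Qed.

Lemma subspaceN Z x : subspace Z -> Z x -> Z (- x).
Proof. by move=> Zs Zx; rewrite -scaleN1r; apply: subspaceZ. Qed.

Lemma subspaceB Z x y : subspace Z -> Z x -> Z y -> Z (x - y).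
Proof. by move=> Zs Zx Zy; apply: subspaceD => //; apply: subspaceN. Qed.

(** Hahn-Banach applied to the distance to [Z], a sublinear functional below the norm that vanishes
    on [Z]. *)
Lemma separating_functional Z v (d : R) : subspace Z ->
    (forall z, Z z -> d <= `|v - z|) ->
  exists f, [/\ bounded_scalar 1 f, forall z, Z z -> f z = 0 & d <= f v].
Proof.
move=> Zs dZ; have [Z0 ZL] := Zs.
pose E x := [set `|x - z| | z in Z].
have lbE x : has_lbound (E x) by exists 0 => _ [z _ <-].
pose p x := inf (E x).
have p_le x z : Z z -> p x <= `|x - z| by move=> Zz; apply: ge_inf => //; exists z.
have p_ge0 x : 0 <= p x.
  by apply: lb_le_inf => [|_ [z _ <-]//]; exists `|x - 0|, 0.
have p_approx x e : 0 < e -> exists z, Z z /\ `|x - z| < p x + e.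
  move=> e0; have [|_ [z Zz <-] H] := @inf_adherent _ (E x) e e0.
    by split => //; exists `|x - 0|, 0.
  by exists z.
have pZ_le a x : 0 < a -> p (a *: x) <= a * p x.
  move=> a0; apply: inf_le_approx => // e e0.
  have [z [Zz xz]] := p_approx x _ (divr_gt0 e0 a0).
  exists `|a *: x - a *: z|; first by exists (a *: z) => //; apply: subspaceZ.
  rewrite -scalerBr normrZ gtr0_norm//.
  have := ltW xz; rewrite -(ler_pM2l a0) mulrDr => /le_trans; apply.
  by rewrite mulrCA divff ?mulr1// gt_eqF.
have p_sub : sublinear p.
  split.
    move=> x y; apply: inf_le_approx => // e e0.
    have e20 : 0 < e / 2 by rewrite divr_gt0.
    have [z [Zz xz]] := p_approx x _ e20; have [t [Zt yt]] := p_approx y _ e20.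
    exists `|x + y - (z + t)|; first by exists (z + t) => //; apply: subspaceD.
    by have := ler_normD (x - z) (y - t); rewrite opprD addrACA; lra.
  move=> a x; rewrite le_eqVlt => /predU1P[<-|a0].
    rewrite scale0r mul0r; apply/eqP; rewrite eq_le p_ge0 andbT.
    by apply: le_trans (p_le _ _ Z0) _; rewrite subr0 normr0.
  apply/eqP; rewrite eq_le pZ_le//=.
  have := pZ_le a^-1 (a *: x); rewrite invr_gt0 => /(_ a0).
  by rewrite scalerK ?gt_eqF// ler_pdivlMl.
have [f [fl fp fv]] := hahn_banach v p_sub.
have p_norm x : p x <= `|x| by rewrite -[x in leRHS]subr0; apply: p_le.
have fN x : - f x <= p (- x) by rewrite -scalarN.
exists f; split.
- split => // x; rewrite mul1r ler_norml (le_trans (fp x))// andbT.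
  by rewrite lerNl (le_trans (fN x))// -(normrN x).
- have p0 z : Z z -> p z <= 0 by move=> /(p_le z); rewrite subrr normr0.
  move=> z Zz; apply/eqP; rewrite eq_le (le_trans (fp z) (p0 _ Zz))/=.
  by rewrite -oppr_le0 (le_trans (fN z))// p0//; apply: subspaceN.
- rewrite fv; apply: lb_le_inf; first by exists `|v - 0|, 0.
  by move=> _ [z Zz <-]; apply: dZ.
Qed.

(** The sum of [Z] and the linear span of [s], with one vector adjoined at a time to allow induction
    on [s]. *)
Fixpoint span_over Z s : set Y :=
  if s is v :: s' then [set y | exists a, span_over Z s' (y - a *: v)] else Z.

Lemma span_over_subspace Z s : subspace Z -> subspace (span_over Z s).
Proof.
move=> Zs; elim: s => //= v s IH; split; first by exists 0; rewrite scale0r subr0; case: IH.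
move=> a x y [b xb] [c yc]; exists (a * b + c).
rewrite scalerDl opprD addrACA -scalerA -scalerBr; case: IH => _; exact.
Qed.

Lemma sub_span_over Z s : Z `<=` span_over Z s.
Proof. by move=> z; elim: s => //= v s IH Zz; exists 0; rewrite scale0r subr0; apply: IH. Qed.

Lemma mem_span_over Z s v : subspace Z -> v \in s -> span_over Z s v.
Proof.
move=> Zs; elim: s => //= w s IH; rewrite inE => /predU1P[->|/IH vs].
  by exists 1; rewrite scale1r subrr; apply: sub_span_over; case: Zs.
by exists 0; rewrite scale0r subr0.
Qed.

Lemma interval_net (M e : R) : 0 < e ->
  exists g : seq R, forall a, `|a| <= M -> exists2 b, b \in g & `|a - b| <= e.
Proof.
move=> e0; exists [seq k%:R * e - M | k <- iota 0 (Num.truncn (2 * M / e)).+1] => a aM.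
have [aM1 aM2] : - M <= a /\ a <= M by apply/andP; rewrite -ler_norml.
have ae0 : 0 <= (a + M) / e by rewrite divr_ge0 ?(ltW e0)//; lra.
have /andP[k1 k2] := truncn_itv ae0.
exists ((Num.truncn ((a + M) / e))%:R * e - M).
  apply/mapP; exists (Num.truncn ((a + M) / e)) => //; rewrite mem_iota add0n ltnS leq0n/=.
  by apply: le_truncn; rewrite ler_pM2r ?invr_gt0//; lra.
move: k1 k2; rewrite ler_pdivlMr// ltr_pdivrMr//.
move: (Num.truncn _) => k; rewrite -natr1 => k1 k2.
by rewrite ger0_norm; lra.
Qed.

(** Bounded sets are precompact modulo [Z]. If [v] has distance at least [d > 0] from the span of
    the rest, its coefficient is at most [r / d] and can be discretized; otherwise [v] is replaced
    by a close vector of that span. *)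
Lemma span_over_net Z s (r e : R) : subspace Z -> 0 < e ->
  exists cs : seq Y, forall y, span_over Z s y -> `|y| <= r ->
    exists c, c \in cs /\ exists2 z, Z z & `|y - c - z| <= e.
Proof.
move=> Zs; elim: s r e => [|v s IH] r e e0.
  exists [:: 0] => y Zy _; exists 0; split; first exact: mem_head.
  by exists y => //; rewrite subr0 subrr normr0 ltW.
have Ws := span_over_subspace s Zs.
have e20 : 0 < e / 2 by rewrite divr_gt0.
have [[d [d0 dW]]|ndW] := pselect (exists d, 0 < d /\
    forall w, span_over Z s w -> d <= `|v - w|).
  have v0 : 0 < `|v| + 1 by rewrite ltr_wpDl.
  have [g gP] := @interval_net (r / d) (e / 2 / (`|v| + 1)) (divr_gt0 e20 v0).
  have [cs csP] := IH (r + r / d * `|v|) (e / 2) e20.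
  exists [seq c + b *: v | c <- cs, b <- g] => y [a ya] yr.
  have ar : `|a| <= r / d.
    have [->|a0] := eqVneq a 0.
      by rewrite normr0 divr_ge0 ?(ltW d0)// (le_trans _ yr).
    rewrite ler_pdivlMr// (le_trans _ yr)//.
    have -> : y = a *: (v - (- a^-1) *: (y - a *: v)).
      by rewrite scaleNr opprK scalerDr scalerA divff// scale1r addrC subrK.
    by rewrite normrZ ler_wpM2l// dW//; apply: subspaceZ.
  have [b bg ab] := gP _ ar.
  have [|c [cs_c [z Zz H]]] := csP (y - a *: v) ya.
    rewrite (le_trans (ler_normB _ _))// lerD// normrZ ler_wpM2r//.
  exists (c + b *: v); split; first exact: allpairs_f.
  exists z => //.
  have -> : y - (c + b *: v) - z = (y - a *: v - c - z) + (a - b) *: v by vector.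
  rewrite (le_trans (ler_normD _ _))// [leRHS](splitr e) lerD// normrZ.
  rewrite (@le_trans _ _ (`|a - b| * (`|v| + 1)))//; first by rewrite ler_wpM2l// lerDl.
  by rewrite -ler_pdivlMr.
have close d : 0 < d -> exists2 w, span_over Z s w & `|v - w| < d.
  move=> d0; apply: contrapT => H; apply: ndW; exists d; split => // w Ww.
  by rewrite leNgt; apply/negP => vw; apply: H; exists w.
have [cs csP] := IH (r + e / 2) (e / 2) e20.
exists cs => y [a ya] yr.
have a0 : 0 < `|a| + 1 by rewrite ltr_wpDl.
have [w Ww vw] := close _ (divr_gt0 e20 a0).
have avw : `|a *: (v - w)| <= e / 2.
  rewrite normrZ (@le_trans _ _ ((`|a| + 1) * `|v - w|))//; first by rewrite ler_wpM2r// lerDl.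
  by rewrite mulrC -ler_pdivlMr// ltW.
have yE : y = (y - a *: v + a *: w) + a *: (v - w) by vector.
have [||c [cs_c [z Zz H]]] := csP (y - a *: v + a *: w).
- by apply: subspaceD => //; apply: subspaceZ.
- rewrite -[_ + a *: w](addrK (a *: (v - w))) -yE.
  by rewrite (le_trans (ler_normB _ _))// lerD.
exists c; split => //; exists z => //.
have -> : y - c - z = (y - a *: v + a *: w - c - z) + a *: (v - w) by vector.
by rewrite (le_trans (ler_normD _ _))// [leRHS](splitr e) lerD.
Qed.

End subspaces.

(** * Subspaces of finite codimension *)

Section finite_codimension.
Variables (R : realType) (Y : completeNormedModType R).
Implicit Types (f g : Y -> R) (x y z v w : Y) (Z W X : set Y) (s : seq Y).

Lemma span_overP Z s y : span_over Z s y <->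
  exists a : nat -> R, Z (y - \sum_(i < size s) a i *: s`_i).
Proof.
elim: s y => [|v s IH] y /=.
  split => [Zy|[a]]; last by rewrite big_ord0 subr0.
  by exists (fun=> 0); rewrite big_ord0 subr0.
split => [[b /IH[a Za]]|[a Za]].
  exists (fun i => if i is j.+1 then a j else b).
  by rewrite big_ord_recl /= opprD addrA.
exists (a 0); apply/IH; exists (fun i => a i.+1).
by move: Za; rewrite big_ord_recl /= opprD addrA.
Qed.

Lemma submod_closed_subspace Z : submod_closed (mem Z) <-> subspace Z.
Proof.
split => [[Z0 ZL]|[Z0 ZL]].
  by split=> [|a x y Zx Zy]; apply: set_mem => //; apply: ZL; apply: mem_set.
split=> [|a x y Zx Zy]; apply: mem_set => //.
by apply: ZL; apply: set_mem.
Qed.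

Lemma finite_codimP Z : finite_codim Z <-> exists s, forall y, span_over Z s y.
Proof.
split => [[n [v vP]]|[s sP]].
  exists (codom v) => y; apply/span_overP; have [a Za] := vP y.
  case: n => [|n] in v vP a Za *.
    exists (fun=> 0); move: Za; rewrite !big_ord0.
    by rewrite big1// => -[i]; rewrite size_codom card_ord.
  exists (a \o inord); move: Za; rewrite size_codom card_ord.
  congr (Z (y - _)); apply: eq_bigr => i _ /=; rewrite inord_val.
  by rewrite (nth_map i) ?size_enum_ord// nth_ord_enum.
exists (size s), (fun i => s`_i) => y; have /span_overP[a Za] := sP y.
by exists (fun i => a i).
Qed.

Lemma cofP Z : cof Z <->
  [/\ subspace Z, closed Z & exists s, forall y, span_over Z s y].
Proof.
split=> [[/submod_closed_subspace ? ? /finite_codimP ?]|[? ? ?]]; split => //.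
  exact/submod_closed_subspace.
exact/finite_codimP.
Qed.

Lemma cof_subspace Z : cof Z -> subspace Z.
Proof. by case/cofP. Qed.

(** Finite codimension is inherited by a subspace [X], with the spanning vectors taken from [X]. At
    most one vector [w] of [X] is needed for each [v] in [s]: its coefficient of [v] is nonzero, so
    multiples of [w] cancel the [v]-part of any vector of [X]. *)
Lemma span_over_sub X Z s : subspace X -> subspace Z ->
    (forall x, X x -> span_over Z s x) ->
  exists s', (forall x, x \in s' -> X x) /\
             forall x, X x -> span_over (Z `&` X) s' x.
Proof.
move=> + Zs; elim: s X => [|v s IH] X Xs sX.
  by exists [::]; split => // x Xx; split => //; apply: sX.
have Ws := span_over_subspace s Zs.
pose X' := X `&` span_over Z s.
have X's : subspace X'.
  case: Xs Ws => X0 XL [W0 WL]; split; first by split.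
  by move=> a x y [Xx Wx] [Xy Wy]; split; [apply: XL|apply: WL].
have [s' [s'X s'P]] := IH X' X's (fun x => @proj2 _ _).
have X'P x : X' x -> span_over (Z `&` X) s' x.
  move/s'P; elim: (s') x => [x [Zx [Xx _]]//|w t IHt x /= [a /IHt]].
  by exists a.
have [[w [Xw nw]]|nX] := pselect (exists w, X w /\ ~ span_over Z s w); last first.
  exists s'; split => [x /s'X[]//|x Xx]; apply: X'P; split => //.
  by apply: contrapT => nx; apply: nX; exists x.
have [a wa] := sX _ Xw.
have a0 : a != 0 by apply/eqP => a0; apply: nw; move: wa; rewrite a0 scale0r subr0.
exists (w :: s'); split.
  by move=> x; rewrite inE => /predU1P[->//|/s'X[]].
move=> x Xx; have [b xb] := sX _ Xx; exists (b / a); apply: X'P; split.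
  by apply: subspaceB => //; apply: subspaceZ.
have -> : x - (b / a) *: w = (x - b *: v) - (b / a) *: (w - a *: v).
  by rewrite scalerBr scalerA divfK//; vector.
by apply: subspaceB => //; apply: subspaceZ.
Qed.

Lemma span_over_cat Z Z' s s' : subspace Z -> (forall x, Z x -> span_over Z' s' x) ->
  forall x, span_over Z s x -> span_over Z' (s ++ s') x.
Proof. by move=> Zs ZZ'; elim: s => //= v s IH x [a /IH]; exists a. Qed.

Lemma cofI Z W : cof Z -> cof W -> cof (Z `&` W).
Proof.
move=> /cofP[Zs Zc [s sP]] /cofP[Ws Wc [t tP]]; apply/cofP; split.
- case: Zs Ws => Z0 ZL [W0 WL]; split; first by split.
  by move=> a x y [Zx Wx] [Zy Wy]; split; [apply: ZL|apply: WL].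
- exact: closedI.
- have [s' [_ s'P]] := @span_over_sub W Z s Ws Zs (fun x _ => sP x).
  exists (t ++ s') => y; exact: span_over_cat Ws s'P _ (tP y).
Qed.

Lemma cofT : cof [set: Y].
Proof. by apply/cofP; split => //; exists [::]. Qed.

Lemma cof_ker r f : bounded_scalar r f -> cof [set x | f x = 0].
Proof.
move=> fb; have [fl _] := fb; apply/cofP; split.
- split => [|a x y /= fx fy]; first exact: scalar0.
  by rewrite (scalarE fl) (scalarE fl) fx fy mulr0 addr0.
- rewrite (_ : mkset _ = f @^-1` [set x | x = 0])//.
  apply: preimage_closed => [x _|]; first exact: bounded_scalar_continuous fb x.
  exact: closed_eq.
- have [[w fw]|nf] := pselect (exists w, f w != 0).
    exists [:: w] => y; exists (f y / f w) => /=.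
    by rewrite !(scalarE fl) divfK// subrr.
  exists [::] => y /=; apply: contrapT => /eqP fy; apply: nf; by exists y.
Qed.

Lemma cof_seq (T : eqType) (Z : T -> set Y) (cs : seq T) :
  (forall c, cof (Z c)) -> cof [set x | forall c, c \in cs -> Z c x].
Proof.
move=> Zc; elim: cs => [|c cs IH].
  rewrite (_ : mkset _ = setT); first exact: cofT.
  by apply/seteqP; split.
rewrite (_ : mkset _ = Z c `&` [set x | forall c, c \in cs -> Z c x]).
  exact: cofI.
apply/seteqP; split => x /=.
  by move=> H; split => [|d dcs]; apply: H; rewrite inE ?eqxx ?dcs ?orbT.
by move=> [Zx H] d; rewrite inE => /predU1P[->//|]; apply: H.
Qed.

(** Pigeonhole on a finite net modulo [Z]: two terms of the bounded sequence share a net point. *)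
Lemma cof_near Z (u : nat -> Y) (r e : R) : cof Z -> 0 < e ->
    (forall n, `|u n| <= r) ->
  exists m n, m <> n /\ exists2 z, Z z & `|u m - u n - z| <= e.
Proof.
move=> /cofP[Zs _ [s sP]] e0 ur; have e20 : 0 < e / 2 by rewrite divr_gt0.
have [cs csP] := @span_over_net _ _ Z s r (e / 2) Zs e20.
have /choice[c cP] n := csP (u n) (sP _) (ur n).
have : ~~ uniq [seq c k | k <- iota 0 (size cs).+1].
  have sub : {subset [seq c k | k <- iota 0 (size cs).+1] <= cs}.
    by move=> _ /mapP[k _ ->]; case: (cP k).
  by apply/negP => /uniq_leq_size /(_ sub); rewrite size_map size_iota ltnn.
have [inj|ninj] := pselect (injective c).
  by rewrite map_inj_uniq ?iota_uniq.
move=> _; have [m [n [cmn mn]]] : exists m n, c m = c n /\ m <> n.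
  apply: contrapT => H; apply: ninj => m n cmn; apply: contrapT => mn.
  by apply: H; exists m, n.
exists m, n; split => //.
have [_ [z Zz uz]] := cP m; have [_ [t Zt ut]] := cP n.
exists (z - t); first exact: subspaceB.
have -> : u m - u n - (z - t) = (u m - c m - z) - (u n - c n - t).
  by rewrite cmn; vector.
by rewrite (le_trans (ler_normB _ _))// [leRHS](splitr e) lerD.
Qed.

(* Mazur's lemma: a suitable [Z] satisfies [`|e + z| >= `|e| / 2] for [e] in
   the span of [E]; then [z] is at distance at least [`|z| / 3] from this span. *)
Lemma cof_annihilator (E : seq Y) : exists2 Z, cof Z &
  forall z, Z z -> exists g, [/\ bounded_scalar 1 g,
    forall e, e \in E -> g e = 0 & `|z| / 3 <= g z].
Proof.
have Zs : subspace [set (0 : Y)].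
  by split => // a x y /= -> ->; rewrite scaler0 addr0.
have Ws := span_over_subspace E Zs.
have quarter : 0 < 1 / 4 :> R by lra.
have [cs csP] := @span_over_net _ _ [set 0] E 1 (1 / 4) Zs quarter.
have /choice[phi phiP] := @norming_functional R Y.
exists [set z | forall c, c \in cs -> phi c z = 0].
  apply: (@cof_seq _ (fun c => [set z | phi c z = 0])) => c.
  exact: cof_ker (phiP c).1.
move=> z Zz.
(* Some net point [c] is within 1/4 of the unit vector in direction [e]; its norming functional is
   at least 1/2 on that unit vector and vanishes at [z]. *)
have half e : span_over [set 0] E e -> `|e| / 2 <= `|e + z|.
  move=> We; have [->|e0] := eqVneq e 0; first by rewrite normr0 mul0r.
  have ne : 0 < `|e| by rewrite normr_gt0.
  have e1 : `| `|e|^-1 *: e| <= 1.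
    by rewrite normrZ ger0_norm ?invr_ge0// mulVf ?gt_eqF.
  have [c [cs_c [_ -> ]]] := csP _ (subspaceZ _ Ws We) e1; rewrite subr0 => ec.
  have [[fl fb] fc] := phiP c.
  have ze : phi c (`|e|^-1 *: e) = phi c (e + z) / `|e|.
    by rewrite !(scalarE fl) (Zz _ cs_c) addr0 mulrC.
  have c1 : 3 / 4 <= `|c|.
    have := ler_normD c (`|e|^-1 *: e - c); rewrite addrC subrK.
    rewrite normrZ ger0_norm ?invr_ge0// mulVf ?gt_eqF//; lra.
  have c2 : `|c| - 1 / 4 <= phi c (e + z) / `|e|.
    rewrite -ze -fc; have := bounded_scalar1_le (c - `|e|^-1 *: e) (conj fl fb).
    by rewrite distrC (scalarB _ _ fl); lra.
  have := bounded_scalar1_le (e + z) (conj fl fb).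
  have : 1 / 2 <= phi c (e + z) / `|e| by lra.
  by rewrite ler_pdivlMr//; lra.
(* From [half], [|z| <= |z - e| + |e| <= 3 |z - e|]. *)
have dz e : span_over [set 0] E e -> `|z| / 3 <= `|z - e|.
  move=> We; have := half (- e) (subspaceN Ws We); rewrite normrN addrC.
  by have := ler_normD (z - e) e; rewrite subrK; lra.
have [g [gb g0 gz]] := separating_functional Ws dz.
by exists g; split => // e eE; apply: g0; apply: mem_span_over.
Qed.

End finite_codimension.

(** * Renorming *)

Section forced_norm.
Variables (R : realType) (Y : completeNormedModType R).
Implicit Types (f g h : Y -> R) (x y z : Y) (E : seq Y) (sigma tau r : R).

(* In the game with [m] rounds, starting from [f], one player names finite sets
   [E] and the other adds [sigma * g] with [g] in the dual ball, [g = 0] on [E];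
   the first player can keep the dual norm of the outcome below [r]. *)
Fixpoint forced sigma (m : nat) f r : Prop :=
  if m is m'.+1 then
    exists E, forall g, bounded_scalar 1 g -> (forall e, e \in E -> g e = 0) ->
      forced sigma m' (fun x => f x + sigma * g x) r
  else bounded_scalar r f.

Lemma bounded_scalar0 r : 0 <= r -> bounded_scalar r ((fun=> 0) : Y -> R).
Proof.
move=> r0; split => [a x y|x]; first by rewrite mulr0 addr0.
by rewrite normr0 mulr_ge0.
Qed.

Lemma bounded_scalar_comb r q (a b : R) f h :
  bounded_scalar r f -> bounded_scalar q h ->
  bounded_scalar (`|a| * r + `|b| * q) (fun x => a * f x + b * h x).
Proof.
move=> [fl fb] [hl hb]; split => [c x y|x]; first by rewrite fl hl; lra.
rewrite (le_trans (ler_normD _ _))// !normrM mulrDl -!mulrA.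
by rewrite lerD// ler_wpM2l.
Qed.

Lemma bounded_scalarN r f : bounded_scalar r f -> bounded_scalar r (fun x => - f x).
Proof.
by move=> [fl fb]; split => [c x y|x]; [rewrite fl; lra|rewrite normrN].
Qed.

Lemma forced_bounded sigma m f r : forced sigma m f r -> bounded_scalar r f.
Proof.
elim: m f => //= m IH f [E /(_ (fun=> 0) (bounded_scalar0 (@ler01 _)) (fun _ _ => erefl))].
move=> /IH; congr bounded_scalar; apply/funext => x; lra.
Qed.

Lemma forcedN sigma m f r : forced sigma m f r -> forced sigma m (fun x => - f x) r.
Proof.
elim: m f => [f /bounded_scalarN//|m IH f /= [E EP]].
exists E => g gb gE; have := EP _ (bounded_scalarN gb) _.
have gE' e : e \in E -> - g e = 0 by move=> /gE ->; rewrite oppr0.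
move=> /(_ gE') /IH; congr forced; apply/funext => x; lra.
Qed.

(** The strategy for [f] is followed; each answer [g] is split as [a * g + (1 - a) * g], and the
    part at [h] grows by at most [sigma] per round. *)
Lemma forced_comb sigma m f r q h (a : R) : 0 <= sigma -> 0 <= a <= 1 ->
  forced sigma m f r -> bounded_scalar q h ->
  forced sigma m (fun x => a * f x + (1 - a) * h x)
    (a * r + (1 - a) * (q + sigma * m%:R)).
Proof.
move=> s0 /andP[a0 a1]; elim: m f q h => [|m IH] f q h /=.
  move=> fb hb; have := bounded_scalar_comb a (1 - a) fb hb.
  by rewrite mulr0 addr0 !ger0_norm// subr_ge0.
move=> [E EP] hb; exists E => g gb gE.
have hb' : bounded_scalar (q + sigma) (fun x => h x + sigma * g x).
  have := bounded_scalar_comb 1 sigma hb gb.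
  rewrite normr1 mul1r mulr1 ger0_norm//; congr bounded_scalar.
  by apply/funext => x; rewrite mul1r.
have := IH _ _ _ (EP g gb gE) hb'.
have -> : a * r + (1 - a) * (q + sigma + sigma * m%:R) =
          a * r + (1 - a) * (q + sigma * m.+1%:R) by rewrite -natr1; lra.
congr forced; apply/funext => x; lra.
Qed.

Lemma bounded_scalarW r q f : r <= q -> bounded_scalar r f -> bounded_scalar q f.
Proof.
by move=> rq [fl fb]; split => // x; rewrite (le_trans (fb x))// ler_wpM2r.
Qed.

Lemma forcedW sigma m f r q : r <= q -> forced sigma m f r -> forced sigma m f q.
Proof.
move=> rq; elim: m f => [f|m IH f /= [E EP]]; first exact: bounded_scalarW.
by exists E => g gb gE; apply: IH; apply: EP.
Qed.

Lemma forced_free sigma m f q : 0 <= sigma -> bounded_scalar q f ->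
  forced sigma m f (q + sigma * m%:R).
Proof.
move=> s0; elim: m f q => [|m IH] f q fb /=; first by rewrite mulr0 addr0.
exists [::] => g gb _.
have -> : q + sigma * m.+1%:R = (q + sigma) + sigma * m%:R by rewrite -natr1; lra.
apply: IH; have := bounded_scalar_comb 1 sigma fb gb.
rewrite normr1 mul1r mulr1 ger0_norm//; congr bounded_scalar.
by apply/funext => x; rewrite mul1r.
Qed.

Lemma forced_translate sigma m f q h r : 0 <= sigma ->
  bounded_scalar q f -> forced 1 m h r ->
  forced sigma m (fun x => f x + sigma * h x) (q + sigma * r).
Proof.
move=> s0 fb; elim: m h => [|m IH] h /=.
  move=> hb; have := bounded_scalar_comb 1 sigma fb hb.
  rewrite normr1 mul1r ger0_norm//; congr bounded_scalar.
  by apply/funext => x; rewrite mul1r.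
move=> [E EP]; exists E => g gb gE; have := IH _ (EP g gb gE).
congr forced; apply/funext => x; lra.
Qed.

Section fixed_length.
Variables (n : nat) (tau : R).
Hypotheses (n0 : (0 < n)%N) (tau0 : 0 < tau).
Hypothesis flat : forced 1 n (fun=> 0) (tau * n%:R).

(** With this step size [n] rounds move a functional by at most 1/2 in norm. *)
Let sigma : R := (2 * n%:R)^-1.

Let nr0 : 0 < n%:R :> R. Proof. by rewrite ltr0n. Qed.
Let sigma0 : 0 < sigma. Proof. by rewrite invr_gt0 mulr_gt0. Qed.
Let sigma_n : sigma * n%:R = 1 / 2.
Proof. by rewrite /sigma invfM -mulrA mulVf ?gt_eqF// mulr1 mul1r. Qed.

(** The average of the values of the games of length [m < n] is at most 1. Upper bounds [rho m]
    stand in for the values, which are infima and might not be attained. *)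
Definition forced_ball f : Prop := exists rho : nat -> R,
  (forall m, (m < n)%N -> forced sigma m f (rho m)) /\
  \sum_(m < n) rho m <= n%:R.

Lemma forced_ball_bounded f : forced_ball f -> bounded_scalar 1 f.
Proof.
move=> [rho [rhoP rhon]]; split; first by case: (forced_bounded (rhoP 0 n0)).
move=> x; rewrite mul1r -(ler_pM2l nr0) (@le_trans _ _ ((\sum_(m < n) rho m) * `|x|))//.
  rewrite mulr_suml mulr_natl -[n in _ *+ n]card_ord -sumr_const ler_sum// => m _.
  by have [_] := forced_bounded (rhoP m (ltn_ord m)); apply.
by rewrite ler_wpM2r.
Qed.

Lemma bounded_forced_ball f : bounded_scalar (1 / 2) f -> forced_ball f.
Proof.
move=> fb; exists (fun=> 1); split => [m mn|]; last by rewrite sumr_const card_ord.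
apply: forcedW (forced_free m (ltW sigma0) fb).
have : sigma * m%:R <= sigma * n%:R by rewrite ler_pM2l// ler_nat ltnW.
by rewrite sigma_n; lra.
Qed.

Lemma forced_ballN f : forced_ball f -> forced_ball (fun x => - f x).
Proof.
by move=> [rho [rhoP rhon]]; exists rho; split => // m mn; apply/forcedN/rhoP.
Qed.

(* Shifting the bounds [rho] by one round loses only the last one, which [flat]
   controls by the first. *)
Lemma forced_ball_step f : forced_ball f -> exists E, forall g,
  bounded_scalar 1 g -> (forall e, e \in E -> g e = 0) ->
  forced_ball (fun x => (1 + 2 * sigma * tau)^-1 * (f x + sigma * g x)).
Proof.
move=> [rho [rhoP rhon]].
(* At [m = n] the bound comes from [flat], played at scale [sigma] around [f]. *)
pose rho' m := if (m < n)%N then rho m else rho 0 + sigma * (tau * n%:R).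
have rho'P m : (m <= n)%N -> forced sigma m f (rho' m).
  rewrite /rho'; case: ltnP => [mn _|nm mn]; first exact: rhoP.
  have -> : m = n by apply/eqP; rewrite eqn_leq mn.
  have := forced_translate (ltW sigma0) (rhoP 0 n0) flat.
  by congr forced; apply/funext => x; rewrite mulr0 addr0.
have /choice[E EP] m : exists E, (m < n)%N -> forall g, bounded_scalar 1 g ->
    (forall e, e \in E -> g e = 0) ->
    forced sigma m (fun x => f x + sigma * g x) (rho' m.+1).
  case: (ltnP m n) => [mn|_]; last by exists [::].
  by have [E EP] := rho'P m.+1 mn; exists E.
(* One finite set contains the first moves of all the games, so a single [g] answers all of them. *)
exists (flatten [seq E m | m <- iota 0 n]) => g gb gE.
set a := _^-1; have st0 : 0 < sigma * tau by rewrite mulr_gt0.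
have c0 : 0 < 1 + 2 * sigma * tau by rewrite -mulrA; lra.
have a01 : 0 <= a <= 1.
  by rewrite invr_ge0 (ltW c0)/= invf_le1// -mulrA; lra.
(* Shrinking is averaging with the zero functional, whose games have value at most
   [sigma * n = 1 / 2]. The factor [a] solves [a * (1 + sigma * tau) + (1 - a) / 2 = 1]. *)
exists (fun m => a * rho' m.+1 + (1 - a) * (1 / 2)); split => [m mn|].
  have gE' e : e \in E m -> g e = 0.
    move=> eE; apply: gE; apply/flattenP; exists (E m) => //.
    by apply/mapP; exists m => //; rewrite mem_iota.
  have := forced_comb (ltW sigma0) a01 (EP m mn g gb gE') (bounded_scalar0 (lexx 0)).
  have -> : (fun x => a * (f x + sigma * g x) + (1 - a) * 0) =
            (fun x => a * (f x + sigma * g x)).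
    by apply/funext => x; rewrite mulr0 addr0.
  apply: forcedW; rewrite lerD2l ler_wpM2l ?subr_ge0; last 2 first.
  - by case/andP: a01.
  - rewrite add0r -sigma_n ler_pM2l// ler_nat; exact: ltnW.
  by [].
have sum_rho' : \sum_(m < n) rho' m.+1 <= n%:R * (1 + sigma * tau).
  have : \sum_(m < n.+1) rho' m = rho' 0 + \sum_(m < n) rho' m.+1.
    by rewrite big_ord_recl.
  rewrite big_ord_recr /= /rho' ltnn n0.
  under eq_bigr => m _ do rewrite ltn_ord.
  by move: rhon; rewrite mulrDr mulr1 [n%:R * _]mulrC mulrA; lra.
rewrite big_split/= -mulr_sumr sumr_const card_ord -mulr_natl.
have : a * \sum_(m < n) rho' m.+1 <= a * (n%:R * (1 + sigma * tau)).
  by rewrite ler_wpM2l//; case/andP: a01.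
move=> /le_trans H; rewrite -lerBrDr; apply: H.
have aE : a * (1 + 2 * sigma * tau) = 1 by rewrite mulVf ?gt_eqF.
suff : n%:R * (a * (1 + sigma * tau)) <= n%:R * (1 - (1 - a) / 2) by lra.
by rewrite ler_pM2l//; lra.
Qed.

Definition forced_norm y : R := sup [set f y | f in forced_ball].

Lemma forced_norm_ubound y : ubound [set f y | f in forced_ball] `|y|.
Proof.
by move=> _ [f /forced_ball_bounded fb <-]; apply: bounded_scalar1_le.
Qed.

Lemma le_forced_norm f y : forced_ball f -> f y <= forced_norm y.
Proof.
by move=> fK; apply: ub_le_sup; [exists `|y|; exact: forced_norm_ubound|exists f].
Qed.

Lemma forced_norm_le_ub y (b : R) : (forall f, forced_ball f -> f y <= b) ->
  forced_norm y <= b.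
Proof.
move=> H; apply: ge_sup => [|_ [f fK <-]]; last exact: H.
exists 0, (fun=> 0) => //; apply: bounded_forced_ball; apply: bounded_scalar0; lra.
Qed.

Lemma forced_norm_le y : forced_norm y <= `|y|.
Proof.
by apply: forced_norm_le_ub => f fK; apply: forced_norm_ubound; exists f.
Qed.

Lemma forced_normD x y : forced_norm (x + y) <= forced_norm x + forced_norm y.
Proof.
apply: forced_norm_le_ub => f fK; have [fl _] := forced_ball_bounded fK.
by rewrite (scalarE fl) lerD// le_forced_norm.
Qed.

Lemma forced_normZ (a : R) x : forced_norm (a *: x) = `|a| * forced_norm x.
Proof.
have le_scale b y : forced_norm (b *: y) <= `|b| * forced_norm y.
  apply: forced_norm_le_ub => f fK; have [fl _] := forced_ball_bounded fK.
  rewrite (scalarE fl); have [b0|b0] := lerP 0 b.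
    by rewrite ger0_norm// ler_wpM2l// le_forced_norm.
  rewrite ltr0_norm// -[b * f y]mulrNN ler_wpM2l ?oppr_ge0 ?(ltW b0)//.
  by have := le_forced_norm y (forced_ballN fK).
have [->|a0] := eqVneq a 0.
  rewrite scale0r normr0 mul0r; apply/eqP; rewrite eq_le; apply/andP; split.
    by have := forced_norm_le 0; rewrite normr0.
  have half0 : 0 <= 1 / 2 :> R by lra.
  exact: le_forced_norm 0 (bounded_forced_ball (bounded_scalar0 half0)).
apply/eqP; rewrite eq_le le_scale/=.
have := le_scale a^-1 (a *: x); rewrite scalerK// normfV.
by rewrite ler_pdivlMl ?normr_gt0.
Qed.

(** Let [f] almost attain the norm at [y] and vanish at [z]. Adding [sigma * g], where [g y = 0] and
    [g z >= |z| / 3], gains at least [sigma * t / 6]; the factor [1 + 2 * sigma * tau] costs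
    [2 * sigma * tau <= sigma * t / 12] up to small errors. *)
Lemma forced_norm_growth (t : R) y : 0 < t < 1 -> tau <= t / 24 ->
    forced_norm y <= 1 ->
  exists2 Z, cof Z & forall z, Z z -> 1 / 2 <= `|z| ->
    forced_norm y + sigma * t / 48 <= forced_norm (y + t *: z).
Proof.
move=> /andP[t0 t1] taut y1; have st0 : 0 < sigma * t by rewrite mulr_gt0.
have eta0 : 0 < sigma * t / 48 by rewrite divr_gt0.
have [|_ [f fK <-] fy] := @sup_adherent _ [set f y | f in forced_ball] _ eta0.
  split; last by exists `|y|; exact: forced_norm_ubound.
  exists 0, (fun=> 0) => //; apply: bounded_forced_ball; apply: bounded_scalar0; lra.
have fb := forced_ball_bounded fK; have [fl _] := fb.
have [E EP] := forced_ball_step fK.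
have [Z cZ ZP] := cof_annihilator (y :: E).
exists (Z `&` [set x | f x = 0]); first exact: cofI cZ (cof_ker fb).
move=> z [Zz fz] z2; have [g [gb gE gz]] := ZP z Zz.
have gy : g y = 0 by apply: gE; rewrite mem_head.
have gE' e : e \in E -> g e = 0 by move=> eE; apply: gE; rewrite inE eE orbT.
have := le_forced_norm (y + t *: z) (EP g gb gE'); apply: le_trans.
have [gl _] := gb; rewrite !(scalarE fl, scalarE gl) fz gy mulr0 add0r addr0.
have tau_s : sigma * tau <= sigma * (t / 24) by rewrite ler_pM2l.
have sn : sigma <= 1 / 2.
  by rewrite -sigma_n ler_peMr ?(ltW sigma0)// ler1n.
have stz : sigma * t * (1 / 6) <= sigma * t * g z by rewrite ler_pM2l//; lra.
have st1 : sigma * t < 1 by rewrite (@lt_trans _ _ t) ?gtr_pMl//; lra.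
rewrite ler_pdivlMl; last by have : 0 < sigma * tau by [rewrite mulr_gt0|]; lra.
have y_st : forced_norm y * (sigma * tau) <= 1 * (sigma * tau).
  by rewrite ler_wpM2r// mulr_ge0// ltW.
have e_st : sigma * t / 48 * (2 * (sigma * tau)) <= sigma * t / 48 * 1.
  by rewrite ler_pM2l//; lra.
move: fy; rewrite -/(forced_norm y); lra.
Qed.

End fixed_length.
End forced_norm.

(** * Summing seminorms to an asymptotically uniformly convex norm *)

Section auc_renorming.
Variables (R : realType) (Y : completeNormedModType R).
Implicit Types (x y z : Y) (p : Y -> R).

Definition seminorm p : Prop :=
  (forall x y, p (x + y) <= p x + p y) /\ (forall a x, p (a *: x) = `|a| * p x).

Lemma seminorm_ge0 p x : seminorm p -> 0 <= p x.
Proof.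
move=> [pD pZ]; have := pD x (- x).
rewrite subrr -(scale0r 0) pZ normr0 mul0r -scaleN1r pZ normrN normr1; lra.
Qed.

Variable p : nat -> Y -> R.
Hypotheses (p_sn : forall i, seminorm (p i)) (p_le : forall i x, p i x <= `|x|).

Let w i : R := 2^-1 ^+ i.+1.
Let w0 i : 0 < w i. Proof. by rewrite exprn_gt0// invr_gt0. Qed.

Let sum_w n : \sum_(i < n) w i <= 1.
Proof.
suff -> : \sum_(i < n) w i = 1 - 2^-1 ^+ n by rewrite gerBl exprn_ge0// invr_ge0.
elim: n => [|n IH]; first by rewrite big_ord0 expr0 subrr.
by rewrite big_ord_recr /= IH /w exprS; lra.
Qed.

Let partial n x := \sum_(i < n) w i * p i x.

Let partial_le n x : partial n x <= `|x|.
Proof.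
rewrite (@le_trans _ _ (\sum_(i < n) w i * `|x|))//.
  by apply: ler_sum => i _; rewrite ler_wpM2l// ltW.
by rewrite -mulr_suml ler_piMl.
Qed.

Let partial_mono m n x : (m <= n)%N -> partial m x <= partial n x.
Proof.
move=> /subnK <-; rewrite addnC /partial big_split_ord /= lerDl.
by apply: sumr_ge0 => i _; rewrite mulr_ge0 ?(ltW (w0 _)) ?seminorm_ge0.
Qed.

Let total x := sup (range (partial^~ x)).

Let total_ub x : has_ubound (range (partial^~ x)).
Proof. by exists `|x| => _ [n _ <-]. Qed.

Let partial_total n x : partial n x <= total x.
Proof. by apply: ub_le_sup => //; exists n. Qed.

Let total_le x (b : R) : (forall n, partial n x <= b) -> total x <= b.
Proof. by move=> H; apply: ge_sup => [|_ [n _ <-]//]; exists (partial 0 x), 0. Qed.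

Let totalZ a x : total (a *: x) = `|a| * total x.
Proof.
have partialZ n b y : partial n (b *: y) = `|b| * partial n y.
  rewrite /partial mulr_sumr; apply: eq_bigr => i _.
  by have [_ ->] := p_sn i; rewrite mulrCA.
have le_scale b y : total (b *: y) <= `|b| * total y.
  by apply: total_le => n; rewrite partialZ ler_wpM2l.
have [->|a0] := eqVneq a 0.
  rewrite normr0 mul0r scale0r; apply/eqP; rewrite eq_le total_le/=.
    by apply: le_trans (partial_total 0 0); rewrite /partial big_ord0.
  by move=> n; rewrite (le_trans (partial_le _ _))// normr0.
apply/eqP; rewrite eq_le le_scale/=.
have := le_scale a^-1 (a *: x); rewrite scalerK// normfV.
by rewrite ler_pdivlMl ?normr_gt0.
Qed.

Let totalD x y : total (x + y) <= total x + total y.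
Proof.
apply: total_le => n; rewrite (@le_trans _ _ (partial n x + partial n y))//.
  rewrite /partial -big_split/=; apply: ler_sum => i _.
  by rewrite -mulrDr ler_wpM2l ?(ltW (w0 _))//; have [] := p_sn i.
by rewrite lerD.
Qed.

Hypothesis p_growth : forall t : R, 0 < t < 1 -> exists i d, 0 < d /\
  forall y, p i y <= 1 -> exists2 Z, cof Z & forall z, Z z -> 1 / 2 <= `|z| ->
    p i y + d <= p i (y + t *: z).

(** Near [y] the [j]-th seminorm grows by [d]; a supporting functional keeps the remaining terms
    from decreasing on its kernel, and the neglected tail at [y] is smaller than half the growth. *)
Lemma auc_convexifiable_family : auc_convexifiable Y.
Proof.
pose N x := `|x| + total x.
have total_ge0 x : 0 <= total x.
  by apply: le_trans (partial_total 0 x); rewrite /partial big_ord0.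
have total_norm x : total x <= `|x| by apply: total_le.
exists N.
  split => [x y|a x|]; rewrite /N.
  - by have := ler_normD x y; have := totalD x y; lra.
  - by rewrite normrZ totalZ mulrDr.
  - exists 1, 2; split => // x; have := total_ge0 x; have := total_norm x; lra.
move=> t t01; have [j [d [d0 grow]]] := p_growth t01.
have wd0 : 0 < w j * d by rewrite mulr_gt0.
apply: (@lt_le_trans _ _ (w j * d / 2)%:E); first by rewrite lte_fin; lra.
apply/ereal_infP => _ [y /= Ny <-].
have pjy : p j y <= 1.
  by apply: le_trans (p_le j y) _; move: Ny (total_ge0 y); rewrite /N; lra.
have [Z cZ ZP] := grow y pjy.
have wd2 : 0 < w j * d / 2 by rewrite divr_gt0.
have [|_ [n0 _ <-] ny] := @sup_adherent _ (range (partial^~ y)) _ wd2.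
  by split => //; exists (partial 0 y), 0.
(* Large enough both for the partial sum to be almost total at [y] and to contain the term [j]. *)
pose n := (n0 + j.+1)%N; have jn : (j < n)%N by rewrite /n addnS ltnS leq_addl.
pose J := Ordinal jn.
pose q x := `|x| + \sum_(i < n | i != J) w i * p i x.
have qE x : `|x| + partial n x = q x + w j * p j x.
  by rewrite /partial (bigD1 J)//= /q; lra.
have q_sub : sublinear q.
  split => [x x'|a x a0]; rewrite /q.
    have : \sum_(i < n | i != J) w i * p i (x + x') <=
        \sum_(i < n | i != J) w i * p i x + \sum_(i < n | i != J) w i * p i x'.
      rewrite -big_split/=; apply: ler_sum => i _.
      by rewrite -mulrDr ler_wpM2l ?(ltW (w0 _))//; have [] := p_sn i.
    by have := ler_normD x x'; lra.
  rewrite normrZ ger0_norm// mulrDr; congr (_ + _); rewrite mulr_sumr.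
  by apply: eq_bigr => i _; have [_ ->] := p_sn i; rewrite ger0_norm// mulrCA.
(* For [z] in the kernel of [f], [q (y + t *: z) >= f y = q y]. *)
have [f [fl fq fy]] := hahn_banach y q_sub.
have q_le x : q x <= 2 * `|x|.
  have : 0 <= w j * p j x by rewrite mulr_ge0 ?(ltW (w0 _))// seminorm_ge0.
  by have := partial_le n x; have := qE x; lra.
have fb : bounded_scalar 2 f.
  split => // x; rewrite ler_norml (le_trans (fq x))// andbT lerNl.
  by rewrite -(scalarE fl) (le_trans (fq _))// (le_trans (q_le _))// normrN.
apply: (@le_trans _ _ (ereal_inf [set (N (y + t *: z) - 1)%:E | z in
    [set z | (Z `&` [set x | f x = 0]) z /\ N z = 1]])); last first.
  apply: ereal_sup_ubound; exists (Z `&` [set x | f x = 0]) => //.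
  exact: cofI cZ (cof_ker fb).
apply/ereal_infP => _ [z /= [[Zz fz] Nz] <-]; rewrite lee_fin.
have z2 : 1 / 2 <= `|z| by move: Nz (total_norm z); rewrite /N; lra.
have g1 : w j * (p j y + d) <= w j * p j (y + t *: z) by rewrite ler_pM2l// ZP.
have f1 := fq (y + t *: z); have := partial_total n (y + t *: z).
have mono : partial n0 y <= partial n y by rewrite partial_mono// /n leq_addr.
have := qE (y + t *: z); have := qE y; move: f1 ny Ny.
by rewrite !(scalarE fl) fz fy mulr0 addr0 -/(total y) /N; lra.
Qed.

End auc_renorming.

(** If the games could be won for every [tau], the norms obtained for a sequence of [tau] tending to
    0 would combine to an asymptotically uniformly convex norm. *)
Lemma not_auc_convexifiable_forced (R : realType) (Y : completeNormedModType R) :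
  ~ auc_convexifiable Y -> exists2 tau : R, 0 < tau &
    forall n, (0 < n)%N -> ~ forced 1 n ((fun=> 0) : Y -> R) (tau * n%:R).
Proof.
move=> nauc; apply: contrapT => H; apply: nauc.
pose tau i : R := (24 * i.+1%:R)^-1.
have tau0 i : 0 < tau i by rewrite invr_gt0 mulr_gt0.
have /choice[n nP] i : exists n, (0 < n)%N /\
    forced 1 n ((fun=> 0) : Y -> R) (tau i * n%:R).
  apply: contrapT => Hn; apply: H; exists (tau i) => // n n0 F.
  by apply: Hn; exists n.
have n0 i := (nP i).1; have nf i := (nP i).2.
apply: (@auc_convexifiable_family _ _ (fun i => @forced_norm R Y (n i))) => [i|i x|t t01].
- by split; [exact: forced_normD (n0 i)|exact: forced_normZ (n0 i)].
- exact: forced_norm_le (n0 i) x.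
(* As [i.+1 > t^-1], this index satisfies [tau i <= t / 24]. *)
have /andP[t0 t1] := t01; pose i := Num.truncn t^-1.
exists i, ((2 * (n i)%:R)^-1 * t / 48); split.
  by rewrite divr_gt0// mulr_gt0// invr_gt0 mulr_gt0// ltr0n.
move=> y; apply: (forced_norm_growth (n0 i) (tau0 i) (nf i)) => //.
rewrite /tau invfM mulrC ler_pM2r ?invr_gt0// invf_ple ?posrE//.
exact/ltW/truncnS_gt.
Qed.

(** * From trees of functionals to trees of vectors *)

Section ultralimits.
Variables (R : realType) (T : Type) (U : set_system T).
Context {U_ultra : UltraFilter U}.

Definition tends (f : T -> R) (l : R) : Prop :=
  forall e, 0 < e -> U [set i | `|f i - l| <= e].

Lemma tends_ex f l e (A : set T) : tends f l -> 0 < e -> U A ->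
  exists2 i, A i & `|f i - l| <= e.
Proof.
by move=> fl e0 UA; have [i [Ai fi]] := filter_ex (filterI UA (fl e e0)); exists i.
Qed.

Lemma tends_exists f (M : R) : (forall i, `|f i| <= M) -> exists l, tends f l.
Proof.
move=> fM; have fM' i : - M <= f i <= M by rewrite -ler_norml.
pose E := [set a | U [set i | a <= f i]].
have ubE : ubound E M.
  by move=> a /filter_ex[i /= /le_trans]; apply; case/andP: (fM' i).
have supE : has_sup E.
  split; last by exists M.
  by exists (- M); apply: filterS filterT => i _ /=; case/andP: (fM' i).
exists (sup E) => e e0; have [a Ea ae] := sup_adherent e0 supE.
have low : U [set i | sup E - e <= f i].
  by apply: filterS Ea => i /=; apply: le_trans; exact: ltW.
have up : U [set i | f i <= sup E + e].
  have [//|nU] := in_ultra_setVsetC [set i | f i <= sup E + e] U_ultra.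
  have : E (sup E + e).
    by apply: filterS nU => i /= /negP; rewrite -ltNge => /ltW.
  by move=> /(sup_upper_bound supE); rewrite gerDl leNgt e0.
apply: filterS (filterI low up) => i [/= l u].
by rewrite ler_norml; apply/andP; split; lra.
Qed.

Lemma tends_unique f l l' : tends f l -> tends f l' -> l = l'.
Proof.
move=> fl fl'; apply/eqP; rewrite -subr_eq0 -normr_le0; apply/ler_addgt0Pr => e e0.
have e20 : 0 < e / 2 by rewrite divr_gt0.
have [i /= fi fi'] := tends_ex fl' e20 (fl _ e20).
have := ler_normD (l - f i) (f i - l'); rewrite addrA subrK (distrC l (f i)); lra.
Qed.

Lemma tends_lin f g (l m a : R) : tends f l -> tends g m ->
  tends (fun i => a * f i + g i) (a * l + m).
Proof.
move=> fl gm e e0; have e20 : 0 < e / 2 by rewrite divr_gt0.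
have a0 : 0 < `|a| + 1 by rewrite ltr_wpDl.
apply: filterS (filterI (fl _ (divr_gt0 e20 a0)) (gm _ e20)) => i [/= fi gi].
have -> : a * f i + g i - (a * l + m) = a * (f i - l) + (g i - m) by lra.
rewrite (le_trans (ler_normD _ _))// [leRHS](splitr e) lerD// normrM.
rewrite (@le_trans _ _ ((`|a| + 1) * `|f i - l|))//.
  by rewrite ler_wpM2r// lerDl.
by rewrite mulrC -ler_pdivlMr.
Qed.

Lemma ultra_pigeonhole (K : eqType) (c : T -> K) (cs : seq K) :
  (forall i, c i \in cs) -> exists k, U [set i | c i = k].
Proof.
move=> ccs; apply: contrapT => H.
have none k : U [set i | c i <> k].
  have [Uk|//] := in_ultra_setVsetC [set i | c i = k] U_ultra.
  by exfalso; apply: H; exists k.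
have : U [set i | c i \notin cs].
  elim: (cs) => [|k s IH]; first by apply: filterS filterT.
  apply: filterS (filterI (none k) IH) => i [/= ck cis].
  by rewrite inE negb_or cis andbT; apply/eqP.
by move=> /filter_ex[i /=]; rewrite ccs.
Qed.

End ultralimits.

(** * Weak cluster points in reflexive spaces *)

Section weak_cluster.
Variables (R : realType) (Y : completeNormedModType R).
Implicit Types (x y z : Y) (Z : set Y) (E : seq Y).

Hypothesis Y_reflexive : reflexive_space Y.

(** The limits of [f (u i)] along [U] depend linearly and boundedly on [f], and so define an element
    of the bidual; reflexivity represents it by [y]. *)
Lemma weak_ultralimit (T : Type) (U : set_system T) (u : T -> Y) :
  UltraFilter U -> (forall i, `|u i| <= 1) ->
  exists2 y, `|y| <= 1 & forall f, dual f -> tends U (f \o u) (f y).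
Proof.
move=> UU u1.
have /choice[L LP] (f : Y -> R) : exists l, dual f -> tends U (f \o u) l.
  have [/dual_bounded_scalar[r [r0 [_ fb]]]|] := pselect (dual f); last by exists 0.
  have [l fl] := @tends_exists R _ U UU (f \o u) r (fun i =>
    le_trans (fb (u i)) (ler_piMr r0 (u1 i))).
  by exists l.
have [y yP] : exists y, forall f, dual f -> L f = f y.
  apply: Y_reflexive; split.
    move=> a f g df dg.
    have dfg : dual (fun x => a * f x + g x).
      have [r [r0 rb]] := dual_bounded_scalar df.
      have [q [q0 qb]] := dual_bounded_scalar dg.
      have := bounded_scalar_dual (bounded_scalar_comb a 1 rb qb).
      by congr dual; apply/funext => x; rewrite mul1r.
    apply: tends_unique (LP _ dfg) _; exact: tends_lin (LP _ df) (LP _ dg).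
  exists 1 => f df; rewrite mul1r; apply/ler_addgt0Pr => e e0.
  have [i _ fi] := tends_ex (LP _ df) e0 filterT.
  have [r [r0 [_ fb]]] := dual_bounded_scalar df.
  have : `|f (u i)| <= dual_norm f.
    apply: ub_le_sup; last by exists (u i) => //; exact: u1.
    exists r => _ [x /= x1 <-]; exact: le_trans (fb x) (ler_piMr r0 x1).
  have := ler_normB (f (u i)) (f (u i) - L f); rewrite subKr.
  by move: fi => /=; lra.
exists y => [|f df]; last by rewrite -yP//; exact: LP.
have [f [fb fy]] := norming_functional y.
have df := bounded_scalar_dual fb; apply/ler_addgt0Pr => e e0.
have [i _ /=] := tends_ex (LP _ df) e0 filterT.
rewrite yP// fy ler_norml => /andP[+ _].
by have := bounded_scalar1_le (u i) fb; have := u1 i; lra.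
Qed.

(** The index sets [E] are directed by inclusion and refined to an ultrafilter. Modulo [Z] a finite
    net makes [u E - y] close to one vector [c0] for most [E]; weak convergence then forces [c0]
    close to [Z]. *)
Lemma weak_cluster (u : seq Y -> Y) : (forall E, `|u E| <= 1) ->
  exists2 y, `|y| <= 1 & forall E0 Z (e : R), cof Z -> 0 < e ->
    exists E, {subset E0 <= E} /\ exists2 z, Z z & `|u E - y - z| <= e.
Proof.
move=> u1.
pose F := filter_from setT (fun E0 : seq Y => [set E : seq Y | {subset E0 <= E}]).
have F_proper : ProperFilter F.
  apply: filter_from_proper; last by move=> E0 _; exists E0.
  apply: filter_from_filter; first by exists [::].
  move=> E1 E2 _ _; exists (E1 ++ E2) => // E sE; split => x xE; apply: sE;
    by rewrite mem_cat xE ?orbT.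
have [U [U_ultra FU]] := ultraFilterLemma F_proper.
have [y y1 yP] := weak_ultralimit U_ultra u1.
exists y => // E0 Z e cZ e0; have [Zs _ [s sP]] := (cofP Z).1 cZ.
have e4 : 0 < e / 4 by rewrite divr_gt0.
have e8 : 0 < e / 8 by rewrite divr_gt0.
have [cs csP] := @span_over_net _ _ Z s 2 (e / 4) Zs e4.
have uy E : `|u E - y| <= 2 by rewrite (le_trans (ler_normB _ _))// [2](_ : _ = 1 + 1)// lerD.
have /choice[c cP] E := csP (u E - y) (sP _) (uy E).
have [c0 Uc0] := ultra_pigeonhole (fun E => (cP E).1).
(* Otherwise a functional vanishing on [Z] is at least [e / 2] at [c0], but weak convergence and the
   net only allow [e / 8 + e / 4]. *)
have [z0 Zz0 cz0] : exists2 z, Z z & `|c0 - z| < e / 2.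
  apply: contrapT => H.
  have far z : Z z -> e / 2 <= `|c0 - z|.
    by move=> Zz; rewrite leNgt; apply/negP => zc; apply: H; exists z.
  have [f [fb fZ fc]] := separating_functional Zs far; have [fl _] := fb.
  have [E /= Ec] := tends_ex (yP f (bounded_scalar_dual fb)) e8 Uc0.
  have [_ [z Zz]] := cP E; rewrite Ec ler_norml => uz /andP[f1 f2].
  have := bounded_scalar1_le (- (u E - y - c0 - z)) fb.
  by rewrite !(scalarE fl) normrN (fZ _ Zz); lra.
have UE0 : U [set E : seq Y | {subset E0 <= E}] by apply: FU; exists E0.
have [E [/= Ec E0E]] := filter_ex (filterI Uc0 UE0).
exists E; split => //; have [_ [z Zz]] := cP E; rewrite Ec => uz.
exists (z0 + z); first exact: subspaceD.
have -> : u E - y - (z0 + z) = (u E - y - c0 - z) + (c0 - z0) by vector.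
by rewrite (le_trans (ler_normD _ _))//; lra.
Qed.

End weak_cluster.

(** * Trees of vectors with bounded sums *)

Section transfer.
Variables (R : realType) (Y : completeNormedModType R).
Implicit Types (x y z : Y) (Z : set Y) (E zs : seq Y) (F g : Y -> R) (r : R).

(* The dual quantifier of [asymptotically], with vectors restricted to [S]. *)
Fixpoint often (S : set Y) (n : nat) (P : seq Y -> Prop) : Prop :=
  if n is m.+1 then
    forall Z, cof Z -> exists x, [/\ Z x, S x & often S m (fun s => P (x :: s))]
  else P [::].

Lemma oftenS S n (P Q : seq Y -> Prop) : (forall s, P s -> Q s) ->
  often S n P -> often S n Q.
Proof.
elim: n P Q => [|n IH] P Q PQ /=; first exact: PQ.
move=> H Z cZ; have [x [Zx Sx xP]] := H Z cZ; exists x; split => //.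
by apply: IH xP => s; exact: PQ.
Qed.

(** At a leaf [y] witnesses that [F] has norm greater than [r]. At an inner node the vectors [y'] of
    suitable children converge weakly to [y], which is expressed by [y' - y] being close to any
    prescribed [Z]. *)
Fixpoint weak_tree (m : nat) F r y : Prop :=
  if m is m'.+1 then
    forall E Z (e : R), cof Z -> 0 < e -> exists g y' z,
      [/\ bounded_scalar 1 g, forall x, x \in E -> g x = 0, `|y'| <= 1,
          Z z /\ `|y' - y - z| <= e
        & weak_tree m' (fun x => F x + 1 * g x) r y']
  else r < F y.

(** Built from the leaves: almost norming vectors are taken there, and at an inner node a weak
    cluster point of the vectors of the children, indexed by the sets that the added functionals
    annihilate. *)
Lemma weak_tree_exists m F r : reflexive_space Y -> 0 <= r -> scalar F ->
  ~ forced 1 m F r -> exists2 y, `|y| <= 1 & weak_tree m F r y.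
Proof.
move=> Yr r0; elim: m F => [|m IH] F Fl /= nF.
  have [x xF] : exists x, r * `|x| < `|F x|.
    apply: contrapT => H; apply: nF; split => // x.
    by rewrite leNgt; apply/negP => xF; apply: H; exists x.
  have x0 : 0 < `|x|.
    rewrite normr_gt0; apply/eqP => x0.
    by move: xF; rewrite x0 (scalar0 Fl) !normr0 mulr0 ltxx.
  exists ((Num.sg (F x) / `|x|) *: x).
    rewrite normrZ normrM normr_sg normfV normr_id -mulrA mulVf ?(gt_eqF x0)// mulr1.
    by case: (F x != 0).
  by rewrite (scalarE Fl) mulrAC -normrEsg ltr_pdivlMr.
have /choice[gy gyP] E : exists gy : (Y -> R) * Y,
    [/\ bounded_scalar 1 gy.1, forall x, x \in E -> gy.1 x = 0, `|gy.2| <= 1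
      & weak_tree m (fun x => F x + 1 * gy.1 x) r gy.2].
  have [g [gb gE gF]] : exists g, [/\ bounded_scalar 1 g,
      forall x, x \in E -> g x = 0 & ~ forced 1 m (fun x => F x + 1 * g x) r].
    apply: contrapT => H; apply: nF; exists E => g gb gE.
    by apply: contrapT => ng; apply: H; exists g.
  have [|y y1 yP] := IH _ _ gF; last by exists (g, y).
  by have [gl _] := gb; move=> a x y; rewrite Fl gl; lra.
have [|y y1 yP] := @weak_cluster _ _ Yr (fun E => (gy E).2).
  by move=> E; case: (gyP E).
exists y => // E Z e cZ e0; have [E' [EE' [z Zz zy]]] := yP E Z e cZ e0.
have [gb gE y'1 tree] := gyP E'.
by exists (gy E').1, (gy E').2, z; split => // x /EE'; exact: gE.
Qed.

(* [s] is the current partial sum, [N] the sum of the norms of its terms and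
   [D] the accumulated error of the approximation of [y] by [s]. *)
Lemma weak_tree_often m F r y s (q N D e : R) : 0 < e <= 1 ->
  0 <= q -> bounded_scalar q F -> `|y| <= 1 -> `|s - y| <= D -> F s <= N ->
  weak_tree m F r y ->
  often [set x | `|x| <= 3] m (fun zs =>
    `|s + \sum_(z <- zs) z| <= 1 + D + m%:R * e /\
    r < N + \sum_(z <- zs) `|z| + (q + m%:R) * (D + m%:R * e)).
Proof.
move=> /andP[e0 e1]; elim: m F y s q N D => [|m IH] F y s q N D q0 Fb y1 sy FN.
  move=> /= rF; rewrite !big_nil !mul0r !addr0; split.
    by have := ler_normD y (s - y); rewrite addrC subrK; lra.
  have [Fl Fq] := Fb; have := Fq (y - s); rewrite ler_norml => /andP[_].
  rewrite !(scalarE Fl) distrC => H; have : q * `|s - y| <= q * D by rewrite ler_wpM2l.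
  lra.
move=> tree Z cZ /=.
(* Since [F z = 0] and [g s = 0], the new functional at the new sum is [F s + g z], so it increases
   by at most [|z|]. *)
have [g [y' [z [gb gs y'1 [[Zz Fz] yz] tree']]]] :=
  tree [:: s] _ e (cofI cZ (cof_ker Fb)) e0.
have [Fl _] := Fb; have [gl _] := gb.
exists z; split => //=.
  have -> : z = y' - y - (y' - y - z) by vector.
  rewrite (le_trans (ler_normB _ _))//.
  by have := ler_normB y' y; lra.
have Fb' : bounded_scalar (q + 1) (fun x => F x + 1 * g x).
  have := bounded_scalar_comb 1 1 Fb gb; rewrite normr1 !mul1r.
  by congr bounded_scalar; apply/funext => x; rewrite mul1r.
have sy' : `|s + z - y'| <= D + e.
  have -> : s + z - y' = (s - y) - (y' - y - z) by vector.
  by rewrite (le_trans (ler_normB _ _))// lerD.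
have FN' : F (s + z) + 1 * g (s + z) <= N + `|z|.
  rewrite (scalarE Fl) (scalarE gl) Fz gs ?mem_head//.
  by have := bounded_scalar1_le z gb; lra.
have q1 : 0 <= q + 1 by lra.
have := IH _ _ _ _ _ _ q1 Fb' y'1 sy' FN' tree'.
apply: oftenS => zs [sum_le norms]; rewrite !big_cons addrA -[m.+1%:R]natr1.
by split; lra.
Qed.

Lemma often_bounded_sum (tau : R) n : reflexive_space Y -> 0 < tau -> (0 < n)%N ->
  ~ forced 1 n ((fun=> 0) : Y -> R) (tau * n%:R) ->
  often [set x | `|x| <= 3] n (fun zs =>
    `|\sum_(z <- zs) z| <= 3 /\ tau / 2 * n%:R < \sum_(z <- zs) `|z|).
Proof.
move=> Yr tau0 n0 nforced; have nr0 : 0 < n%:R :> R by rewrite ltr0n.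
have nr1 : 1 <= n%:R :> R by rewrite ler1n.
have zl : scalar ((fun=> 0) : Y -> R) by move=> a x y; rewrite mulr0 addr0.
have [|y y1 tree] := weak_tree_exists Yr _ zl nforced.
  by rewrite mulr_ge0// ltW.
(* The total error [n * e] must be at most 1 to keep the sums below 3, and at most [tau / 2] to lose
   at most half of [tau * n]. *)
pose e := Num.min 1 (tau / 2) / n%:R.
have m0 : 0 < Num.min 1 (tau / 2) by rewrite lt_min ltr01 divr_gt0.
have ne : n%:R * e = Num.min 1 (tau / 2) by rewrite mulrC divfK// gt_eqF.
have m1 : Num.min 1 (tau / 2) <= 1 by rewrite ge_min lexx.
have m2 : Num.min 1 (tau / 2) <= tau / 2 by rewrite ge_min lexx orbT.
have e01 : 0 < e <= 1.
  rewrite divr_gt0//= ler_pdivrMr// mul1r; exact: le_trans m1 nr1.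
have yy : `|y - y| <= 0 by rewrite subrr normr0.
(* The partial sums start at [y] itself with the zero functional, so that [q], [N] and [D] are 0. *)
have := weak_tree_often e01 (lexx 0) (bounded_scalar0 Y (lexx 0)) y1 yy (lexx 0) tree.
apply: oftenS => zs; rewrite !add0r addr0 ne => -[sum_le norms].
split.
  have := ler_normB (y + \sum_(z <- zs) z) y; rewrite addrAC subrr add0r; lra.
have : n%:R * Num.min 1 (tau / 2) <= n%:R * (tau / 2) by rewrite ler_pM2l.
lra.
Qed.

End transfer.

(** * Asymptotic c_0 structure *)

Section c0_structure.
Variables (R : realType) (Y : completeNormedModType R).
Implicit Types (x y z w : Y) (Z S : set Y) (s t xs zs : seq Y) (P Q : seq Y -> Prop).

(** If [P] fails, some [W] excludes it after every first vector in [W]; restricted to [W], induction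
    leaves only [Q]. *)
Lemma often_or S n P Q : often S n (fun s => P s \/ Q s) -> often S n P \/ often S n Q.
Proof.
elim: n P Q => // n IH P Q /= H.
have [|nP] := pselect (often S n.+1 P); first by left.
right=> Z cZ; have [W [cW WP]] : exists W, cof W /\
    forall x, W x -> S x -> ~ often S n (fun s => P (x :: s)).
  apply: contrapT => H'; apply: nP => W cW; apply: contrapT => H2; apply: H'.
  by exists W; split => // x Wx Sx xP; apply: H2; exists x.
have [x [[Zx Wx] Sx /IH[]]] := H _ (cofI cZ cW); first by move/(WP _ Wx Sx).
by exists x.
Qed.

Lemma often_sub S n P Z : cof Z -> often S n P ->
  often S n (fun s => [/\ P s, size s = n & forall x, x \in s -> Z x /\ S x]).
Proof.
move=> cZ; elim: n P => [|n IH] P /=; first by split.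
move=> H W cW; have [x [[Wx Zx] Sx xP]] := H _ (cofI cW cZ); exists x; split => //.
apply: oftenS (IH _ xP) => s [Ps <- sZ]; split => // y.
by rewrite inE => /predU1P[->|/sZ].
Qed.

Lemma often_ex S n P : often S n P -> exists s, P s.
Proof.
elim: n P => [|n IH] P /=; first by exists [::].
by move=> /(_ _ (@cofT R Y))[x [_ _ /IH[s Ps]]]; exists (x :: s).
Qed.

Lemma often_cat S m n P : often S (m + n) P ->
  often S m (fun s => often S n (fun t => P (s ++ t))).
Proof.
elim: m P => //= m IH P H Z cZ.
by have [x [Zx Sx /IH xP]] := H Z cZ; exists x.
Qed.

Let sphere : set Y := [set x | `|x| = 1].

Lemma often_asymptotically n P Q : often sphere n P -> asymptotically n Q ->
  often sphere n (fun s => P s /\ Q s).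
Proof.
elim: n P Q => // n IH P Q /= H [W cW WQ] Z cZ.
have [x [[Zx Wx] x1 xP]] := H _ (cofI cZ cW); exists x; split => //.
exact: IH xP (WQ x Wx x1).
Qed.

Lemma not_often n P : ~ often sphere n P -> asymptotically n (fun s => ~ P s).
Proof.
elim: n P => // n IH P /= nP; apply: contrapT => H; apply: nP => Z cZ.
apply: contrapT => H2; apply: H; exists Z => // x Zx x1; apply: IH => xP.
by apply: H2; exists x.
Qed.

Fixpoint cube_sums s : set Y :=
  if s is x :: s' then [set y | exists a, `|a| <= 1 /\ cube_sums s' (y - a *: x)]
  else [set 0].

(** An upper c_0 estimate: sums with coefficients in [[-1, 1]] have norm at most [K]. *)
Definition upper_bounded (K : R) s : Prop := forall y, cube_sums s y -> `|y| <= K.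

Lemma cube_sums0 s : cube_sums s 0.
Proof. by elim: s => //= x s IH; exists 0; rewrite normr0 scale0r subr0. Qed.

Lemma cube_sumsZ s (c : R) y : `|c| <= 1 -> cube_sums s y -> cube_sums s (c *: y).
Proof.
move=> c1; elim: s y => [|x s IH] y /=; first by move=> ->; rewrite scaler0.
move=> [a [a1 /IH H]]; exists (c * a); split; first by rewrite normrM mulr_ile1.
by rewrite -scalerA -scalerBr.
Qed.

Lemma cube_sums_cat s t y z : cube_sums s y -> cube_sums t z ->
  cube_sums (s ++ t) (y + z).
Proof.
elim: s y => [|x s IH] y /=; first by move=> ->; rewrite add0r.
by move=> [a [a1 /IH H]] /H; exists a; rewrite addrAC.
Qed.

Lemma cube_sums_rev s y : cube_sums s y -> cube_sums (rev s) y.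
Proof.
elim: s y => //= x s IH y [a [a1 /IH H]]; rewrite rev_cons -cats1.
rewrite -[y](subrK (a *: x)); apply: cube_sums_cat => //=.
by exists a; rewrite subrr.
Qed.

Lemma cube_sums_subspace Z s y : subspace Z -> (forall x, x \in s -> Z x) ->
  cube_sums s y -> Z y.
Proof.
move=> Zs; elim: s y => [|x s IH] y sZ /=; first by move=> ->; case: Zs.
move=> [a [_ /IH H]]; rewrite -[y](subrK (a *: x)); apply: subspaceD => //.
  by apply: H => z zs; apply: sZ; rewrite inE zs orbT.
by apply: subspaceZ => //; apply: sZ; rewrite mem_head.
Qed.

Fixpoint sign_sums s : set Y :=
  if s is x :: s' then [set y | sign_sums s' (y - x) \/ sign_sums s' (y + x)]
  else [set 0].

(* The norm is convex, so that it is maximal at a vertex of the cube. *)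
Lemma cube_sums_sign s (B : R) p : (forall y, sign_sums s y -> `|p + y| <= B) ->
  forall y, cube_sums s y -> `|p + y| <= B.
Proof.
elim: s p => [|x s IH] p /= sB y; first by move=> ->; apply: sB.
move=> [a []]; rewrite ler_norml => /andP[a1 a2] sy.
have Hp : `|p + x + (y - a *: x)| <= B.
  by apply: IH sy => z sz; rewrite -addrA; apply: sB; left; rewrite addrAC subrr add0r.
have Hm : `|p - x + (y - a *: x)| <= B.
  by apply: IH sy => z sz; rewrite -addrA; apply: sB; right; rewrite addrAC addNr add0r.
have -> : p + y = ((1 + a) / 2) *: (p + x + (y - a *: x)) +
                  ((1 - a) / 2) *: (p - x + (y - a *: x)) by vector.
have h1 : 0 <= (1 + a) / 2 by lra.
have h2 : 0 <= (1 - a) / 2 by lra.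
rewrite (le_trans (ler_normD _ _))// normrZ (ger0_norm h1) normrZ (ger0_norm h2).
by have := ler_wpM2l h1 Hp; have := ler_wpM2l h2 Hm; lra.
Qed.

(** The terms [zs] may vanish, so unit vectors [xs] of which they are multiples are carried along;
    the asymptotic unconditionality applies to these. *)
Fixpoint aligned xs zs : Prop :=
  match xs, zs with
  | [::], [::] => True
  | x :: xs', z :: zs' => (exists a : R, z = a *: x) /\ aligned xs' zs'
  | _, _ => False
  end.

Lemma aligned_sums xs zs : aligned xs zs -> exists a : nat -> R,
  \sum_(z <- zs) z = \sum_(j < size xs) a j *: xs`_j /\
  forall y, sign_sums zs y -> exists eps : nat -> bool,
    y = \sum_(j < size xs) ((-1) ^+ eps j * a j) *: xs`_j.
Proof.
elim: xs zs => [|x xs IH] [|z zs]//=.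
  exists (fun=> 0); rewrite big_nil big_ord0; split => // y ->.
  by exists (fun=> false); rewrite big_ord0.
move=> [[a0 ->] /IH[a [aE aS]]]; exists (fun i => if i is j.+1 then a j else a0).
split; first by rewrite big_cons big_ord_recl /= aE.
have step y (b : bool) : sign_sums zs (y - (-1) ^+ b *: (a0 *: x)) ->
    exists eps : nat -> bool, y = \sum_(j < (size xs).+1)
      ((-1) ^+ eps j * (if (j : nat) is i.+1 then a i else a0)) *: (x :: xs)`_j.
  move=> /aS[eps yE]; exists (fun i => if i is j.+1 then eps j else b).
  by rewrite big_ord_recl /= -yE -scalerA addrC subrK.
move=> y [H|H]; [apply: (step y false)|apply: (step y true)].
  by rewrite expr0 scale1r.
by rewrite expr1 scaleN1r opprK.
Qed.

Lemma unconditional_upper_bounded (C : R) xs zs : unconditional C xs ->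
  aligned xs zs -> upper_bounded (C * `|\sum_(z <- zs) z|) zs.
Proof.
move=> Cxs /aligned_sums[a [aE aS]] y sy; rewrite -[y]add0r.
apply: cube_sums_sign sy => {}y /aS[eps ->]; rewrite add0r aE; exact: Cxs.
Qed.

(** A retained [x] satisfies [z = a *: x] with [|a| >= e], so that [e *: x] is a multiple of [z] by
    a factor of modulus at most 1. Discarded terms get coefficient 0. *)
Lemma aligned_mask xs zs (e : R) y : 0 < e -> (forall x, x \in xs -> `|x| = 1) ->
  aligned xs zs -> cube_sums (mask [seq e <= `|z| | z <- zs] xs) y ->
  cube_sums zs (e *: y).
Proof.
move=> e0; elim: xs zs y => [|x xs IH] [|z zs]// y xs1 /=.
  by move=> _ ->; rewrite scaler0.
have x1 : `|x| = 1 by apply: xs1; rewrite mem_head.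
have {}IH := IH _ _ (fun w h => xs1 w (mem_behead (s := x :: xs) h)).
move=> [[a zE] al]; have az : `|z| = `|a| by rewrite zE normrZ x1 mulr1.
case: ifP => [za [b [b1 /IH H]]|_ /IH H]; last first.
  by exists 0; rewrite normr0 scale0r subr0; split => //; exact: H.
have a0 : 0 < `|a| by rewrite -az; apply: lt_le_trans za.
exists (e * b / a); split.
  rewrite !normrM normfV (gtr0_norm e0) ler_pdivrMr// mul1r.
  by rewrite (@le_trans _ _ e)// -?az// ler_piMr// ltW.
rewrite zE scalerA divfK; last by rewrite -normr_gt0.
by rewrite -scalerA -scalerBr; apply: H.
Qed.

Lemma norm_sum_count zs (e B : R) : 0 <= e <= B -> (forall z, z \in zs -> `|z| <= B) ->
  \sum_(z <- zs) `|z| <= B * (count id [seq e <= `|z| | z <- zs])%:R + e * (size zs)%:R.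
Proof.
move=> /andP[e0 eB]; elim: zs => [|z zs IH] zB /=; first by rewrite big_nil !mulr0 addr0.
have {}IH := IH (fun w h => zB w (mem_behead (s := z :: zs) h)).
have := zB z (mem_head _ _); rewrite big_cons natrD -[(size zs).+1%:R]natr1.
by case: (lerP e `|z|) => /= ze zB'; lra.
Qed.

Lemma often_subseq S P : (forall s t, P (s ++ t) -> P s) -> forall n k p,
  often S n (fun s => exists m : bitseq,
    [/\ size m = size s, (k <= count id m)%N & P (p ++ mask m s)]) ->
  often S k (fun s => P (p ++ s)).
Proof.
move=> P_pre; elim=> [|n IH] [|k] p.
- by move=> [m [_ _ /P_pre]]; rewrite /= cats0.
- by move=> [[|b m] []].
- by move=> /often_ex[s [m [_ _ /P_pre]]]; rewrite /= cats0.
move=> H.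
pose A x s := exists m : bitseq, [/\ size m = size s, (k <= count id m)%N
  & P (rcons p x ++ mask m s)].
pose B s := exists m : bitseq, [/\ size m = size s, (k.+1 <= count id m)%N
  & P (p ++ mask m s)].
have [/IH//|nB] := pselect (often S n B).
move=> Z cZ; have [x [Zx Sx xP]] := H Z cZ; exists x; split => //.
have : often S n (fun s => A x s \/ B s).
  apply: oftenS xP => s [[|[] m] [//= [sm] km Pm]]; [left|right]; exists m; split => //.
  by rewrite cat_rcons.
move=> /often_or[/IH|//]; apply: oftenS => s; by rewrite cat_rcons.
Qed.

Lemma often_normalize n P (B : R) :
  (forall Z, cof Z -> exists x, Z x /\ sphere x) ->
  often [set x | `|x| <= B] n P ->
  often sphere n (fun xs => exists zs, [/\ aligned xs zs, P zs,
    size zs = n & forall z, z \in zs -> `|z| <= B]).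
Proof.
move=> unit; elim: n P => [|n IH] P /=; first by exists [::].
move=> H Z cZ; have [z [Zz zB /IH zP]] := H Z cZ.
have [x [Zx x1 [a zE]]] : exists x, [/\ Z x, sphere x & exists a : R, z = a *: x].
  have [z0|z0] := eqVneq z 0.
    have [x [Zx x1]] := unit Z cZ; exists x; split => //.
    by exists 0; rewrite scale0r.
  exists (`|z|^-1 *: z); split.
  - exact: subspaceZ (cof_subspace cZ) Zz.
  - by rewrite /sphere /= normrZ normfV normr_id mulVf// normr_eq0.
  - by exists `|z|; rewrite scalerA divff ?scale1r// normr_eq0.
exists x; split => //; apply: oftenS zP => s [zs [al Pzs <- zsB]].
exists (z :: zs); split => //; first by split => //; exists a.
by move=> w; rewrite inE => /predU1P[->|/zsB].
Qed.

Lemma upper_bounded_prefix K s t : upper_bounded K (s ++ t) -> upper_bounded K s.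
Proof.
move=> H y sy; apply: H; rewrite -[y]addr0; apply: cube_sums_cat => //.
exact: cube_sums0.
Qed.

Lemma often_upper_bounded : reflexive_unconditional Y -> ~ auc_convexifiable Y ->
  exists K, forall k, often sphere k (upper_bounded K).
Proof.
move=> [Yr [C [C1 CY]]] /not_auc_convexifiable_forced[tau tau0 nforced].
exists (4 / tau * (C * 3)) => k.
pose n := (Num.truncn (12 * k%:R / tau)).+1.
have tau4 : 0 < tau / 4 by rewrite divr_gt0.
have nk : 12 * k%:R < tau * n%:R by rewrite [tau * _]mulrC -ltr_pdivrMr// truncnS_gt.
have n_gt0 : (0 < n)%N by [].
clearbody n; have n0 : 0 < n%:R :> R by rewrite ltr0n.
have H := often_bounded_sum Yr tau0 n_gt0 (nforced n n_gt0).
(* The lower bound on the sum of norms prevents all vectors chosen in [Z] from vanishing. *)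
have unit Z : cof Z -> exists x, Z x /\ sphere x.
  move=> cZ; have [zs [[_ zs0] _ zsZ]] := often_ex (often_sub cZ H).
  have [[z [zzs z0]]|nz] := pselect (exists z, z \in zs /\ z != 0).
    exists (`|z|^-1 *: z); split.
      by apply: subspaceZ (cof_subspace cZ) _; case: (zsZ z zzs).
    by rewrite /sphere /= normrZ normfV normr_id mulVf// normr_eq0.
  exfalso; move: zs0; rewrite big1_seq; last first.
    move=> z /= zzs; apply/eqP; rewrite normr_eq0; apply: contrapT => /negP z0.
    by apply: nz; exists z.
  by apply/negP; rewrite -leNgt mulr_ge0 ?(ltW n0)// divr_ge0// ltW.
have := often_asymptotically (often_sub (@cofT R Y) (often_normalize unit H)) (CY n).
move=> {}H; apply: (@often_subseq _ _ (@upper_bounded_prefix _) n k [::]).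
apply: oftenS H => xs [[[zs [al [sum3 norms] zsn zs3]] xsn xs1] Cxs].
(* Terms are at most 3 and small ones contribute at most [tau / 4 * n] in total, so more than
   [tau * n / 12 > k] are large. If [tau / 4 > 3], the sum of norms would be too large. *)
exists [seq tau / 4 <= `|z| | z <- zs]; split; first by rewrite size_map zsn xsn.
  have [tau12|tau12] := lerP (tau / 4) 3.
    have e3 : 0 <= tau / 4 <= 3 by rewrite (ltW tau4).
    have := norm_sum_count e3 zs3; rewrite zsn => sums.
    rewrite -(ler_nat R); lra.
  have : \sum_(z <- zs) `|z| <= \sum_(z <- zs) (3 : R).
    by rewrite big_seq [leRHS]big_seq; apply: ler_sum => z /zs3.
  have -> : \sum_(z <- zs) (3 : R) = n%:R * 3.
    by rewrite big_const_seq count_predT zsn iter_addr addr0 mulr_natl.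
  have : n%:R * 12 < n%:R * tau by rewrite ltr_pM2l//; lra.
  by lra.
move=> y ysum; have := aligned_mask tau4 (fun x h => (xs1 x h).2) al ysum.
move=> /(unconditional_upper_bounded Cxs al); rewrite normrZ gtr0_norm//.
rewrite -ler_pdivlMl// invf_div => /le_trans; apply.
by rewrite ler_pM2l ?divr_gt0// ler_pM2l//; apply: lt_le_trans C1.
Qed.

(** Each stretch of [n] vectors can be chosen to have a cube sum [y] with [|y| > K]. Normalizing [y]
    divides by more than [K], so [K] times a cube sum of such blocks is a cube sum of the original
    vectors. *)
Lemma often_blocks n (K : R) : 0 < K -> asymptotically n (fun s => ~ upper_bounded K s) ->
  forall m P, often sphere (m * n) P -> often sphere m (fun us =>
    exists2 s, P s & forall w, cube_sums us w -> cube_sums s (K *: w)).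
Proof.
move=> K0 nK; elim=> [|m IH] P.
  by move=> P0; exists [::] => // w ->; rewrite scaler0.
rewrite mulSn => /often_cat H Z cZ.
have := often_asymptotically (often_sub cZ H) nK.
move=> /often_ex[x [[xP _ xZ] nx]].
have [y [xy yK]] : exists y, cube_sums x y /\ K < `|y|.
  apply: contrapT => H'; apply: nx => y xy; rewrite leNgt; apply/negP => yK.
  by apply: H'; exists y.
have y0 : 0 < `|y| := lt_trans K0 yK.
exists (`|y|^-1 *: y); split.
- have Zs := cof_subspace cZ; apply: subspaceZ => //.
  by apply: cube_sums_subspace xy => // z /xZ[].
- by rewrite /sphere /= normrZ normfV normr_id mulVf// gt_eqF.
apply: oftenS (IH _ xP) => us [s Ps sus]; exists (x ++ s) => // w /= [b [b1 /sus H2]].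
have -> : K *: w = (K * b / `|y|) *: y + K *: (w - b *: (`|y|^-1 *: y)) by vector.
apply: cube_sums_cat H2; apply: cube_sumsZ xy.
rewrite !normrM normfV normr_id (gtr0_norm K0) ler_pdivrMr// mul1r.
by apply: le_trans (ltW yK); rewrite ler_piMr// ltW.
Qed.

(* James' argument for the non-distortability of c_0: if the bound [K] can be
   forced for all lengths but [2 / 3 * K] cannot, then normalized blocks of norm
   greater than [2 / 3 * K] satisfy the bound [3 / 2]. *)
Lemma often_almost_c0 K0 : (forall k, often sphere k (upper_bounded K0)) ->
  forall k, often sphere k (upper_bounded (3 / 2)).
Proof.
move=> all0.
have ge1 K : (forall k, often sphere k (upper_bounded K)) -> 1 <= K.
  move=> /(_ 1) /= /(_ _ (@cofT R Y))[x [_ x1 Kx]]; rewrite -[1]x1; apply: Kx.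
  by exists 1; rewrite normr1 scale1r subrr.
have [K [allK [n nK]]] : exists K, (forall k, often sphere k (upper_bounded K)) /\
    exists n, ~ often sphere n (upper_bounded (2 / 3 * K)).
  apply: contrapT => H.
  have step K : (forall k, often sphere k (upper_bounded K)) ->
      forall k, often sphere k (upper_bounded (2 / 3 * K)).
    move=> allK k; apply: contrapT => nk; apply: H; exists K; split => //.
    by exists k.
  (* Repeated improvement would push the bound below 1, the least possible value since a unit vector
     is itself a cube sum. *)
  have iter j : forall k, often sphere k (upper_bounded ((2 / 3) ^+ j * K0)).
    elim: j => [|j IH]; first by rewrite expr0 mul1r.
    by rewrite exprS -mulrA; apply: step.
  pose j := Num.truncn (2 * K0); have := truncnS_gt (2 * K0); rewrite -/j => jK.
  have K1 := ge1 _ all0; have := ge1 _ (iter j.+1).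
  have : (3 / 2 : R) ^+ j.+1 * ((2 / 3) ^+ j.+1 * K0) = K0.
    rewrite mulrA -exprMn (_ : 3 / 2 * (2 / 3) = 1) ?expr1n ?mul1r//; lra.
  move: (_ * K0) => A; have half0 : 0 <= 1 / 2 :> R by lra.
  have := bernoulli j.+1 half0; rewrite (_ : 1 + 1 / 2 = 3 / 2); last by lra.
  rewrite -[j.+1%:R]natr1 in jK *; move=> b AE A1.
  have : (3 / 2 : R) ^+ j.+1 * 1 <= (3 / 2) ^+ j.+1 * A.
    by rewrite ler_wpM2l// exprn_ge0//; lra.
  by rewrite AE; lra.
have K1 := ge1 _ allK; have K'0 : 0 < 2 / 3 * K by lra.
move=> m; have := often_blocks K'0 (not_often nK) (allK (m * n)%N).
apply: oftenS => us [s sK sus] w /sus/sK; rewrite normrZ gtr0_norm// mulrC.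
by rewrite -ler_pdivlMr// => /le_trans; apply; rewrite ler_pdivrMr//; lra.
Qed.

End c0_structure.

(** * Embedding the diamonds *)

Section diamond_geometry.
Variable R : realType.

Definition side (G : graph) (e : edge G) (s : bool) : vertex G :=
  if s then (ends e).2 else (ends e).1.

Lemma adjacent_side (G : graph) (e : edge G) s : adjacent (side e s) (side e (~~ s)).
Proof. by exists e; case: s; [right|left]; rewrite /side -surjective_pairing. Qed.

Lemma adjacentP (G : graph) (u v : vertex G) : adjacent u v ->
  exists e s, u = side e s /\ v = side e (~~ s).
Proof.
by move=> [e [|] ee]; exists e; [exists false|exists true]; rewrite /side /= ee.
Qed.

Lemma walk1 (G : graph) (u v : vertex G) : adjacent u v -> walk u 1 v.
Proof. exact: walk_rcons (walk_nil _). Qed.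

Lemma path_dist_le (G : graph) (u v : vertex G) n : walk u n v ->
  path_dist R u v <= n%:R.
Proof.
move=> uv; apply: ge_inf; last by exists n.
by exists 0 => _ [m _ <-]; exact: ler0n.
Qed.

Lemma path_dist_ge k (u v : vertex (diamond k)) (b : R) :
  (forall n, walk u n v -> b <= n%:R) -> b <= path_dist R u v.
Proof.
move=> H; apply: lb_le_inf => [|_ [n uv <-]]; last exact: H.
by have [n uv] := diamond_connected u v; exists n%:R, n.
Qed.

Lemma adjacent_new (G : graph) (e : edge G) n s :
  adjacent (inl (side e s) : vertex (subdivide G)) (inr (e, n)).
Proof. by exists (e, n, s); left. Qed.

Lemma walk_subdivide (G : graph) (u v : vertex G) n : walk u n v ->
  walk (inl u : vertex (subdivide G)) n.*2 (inl v).
Proof.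
elim=> [|m x y _ IH /adjacentP[e [s [xE yE]]]]; first exact: walk_nil.
rewrite doubleS; apply: (@walk_rcons (subdivide G) _ _ (inr (e, 0))).
  by apply: walk_rcons IH _; rewrite xE; exact: adjacent_new.
by rewrite yE; apply/adjacent_sym/adjacent_new.
Qed.

(** The numbers [t] are lengths of walks from the two ends of [e] to [w]; the ends lie at
    consecutive levels around [w]. *)
Definition pole (G : graph) (e : edge G) (w : vertex G) (t : bool -> nat) : Prop :=
  (forall s, walk (side e s) (t s) w) /\
  (t true = (t false).+1 \/ t false = (t true).+1).

(** Old lengths double, and the new vertex reaches [w] through the nearer end [s] in
    [2 * t s + 1 = t false + t true] steps. *)
Lemma pole_subdivide (G : graph) (e : edge G) w t n b : pole e w t ->
  pole (G := subdivide G) (e, n, b) (inl w)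
    (fun s => if s then t false + t true else (t b).*2)%N.
Proof.
move=> [tw t1]; split; last by case: b t1 => -[->|->]; [right|left|left|right]; lia.
move=> [] /=; last by apply: walk_subdivide (tw b).
have [s ->] : exists s, (t false + t true)%N = (t s).*2.+1.
  by case: t1 => ->; [exists false|exists true]; lia.
rewrite -add1n; apply: walk_trans (walk_subdivide (tw s)).
exact/walk1/adjacent_sym/adjacent_new.
Qed.

(** The history of an edge under subdivision, most recent choice first, so that the suffixes of an
    address are its ancestors in the tree of vectors. *)
Fixpoint address (k : nat) : edge (diamond k) -> seq nat :=
  match k with
  | 0 => fun _ => [::]
  | k'.+1 => fun enb : edge (diamond k') * nat * bool =>
      let: (e, n, b) := enb in (b : nat) :: n :: address e
  end.

Lemma size_address k (e : edge (diamond k)) : size (address e) = k.*2.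
Proof. by elim: k e => [|k IH]//= [[e n] b] /=; rewrite IH. Qed.

Lemma vertex_side k (v : vertex (diamond k)) : exists e s, v = side e s.
Proof.
elim: k v => [|k IH]; first by move=> v; exists tt, v; case: v.
move=> [w|[e n]]; last by exists (e, n, false), true.
by have [e [s ->]] := IH w; exists (e, 0, s), false.
Qed.

Section embedding.
Variables (Y : completeNormedModType R) (x : seq nat -> Y) (g : seq nat -> Y -> R).
Variable K : nat.
Implicit Types (l m : seq nat).

Fixpoint chain l : seq Y := x l :: (if l is _ :: l' then chain l' else [::]).

Hypothesis gb : forall l, bounded_scalar 3 (g l).
Hypothesis gx : forall l, (size l <= K.*2)%N -> g l (x l) = 1.
Hypothesis gx0 : forall l m, l <> m -> g l (x m) = 0.
Hypothesis upper : forall l, size l = K.*2 -> upper_bounded (3 / 2) (chain l).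

(* [2 ^ k] times the embedding in which a new vertex is sent to the midpoint of
   the images of its neighbours plus a multiple of a new vector. *)
Fixpoint embed (k : nat) : vertex (diamond k) -> Y :=
  match k with
  | 0 => fun v : bool => if v then x [::] else 0
  | k'.+1 => fun v : vertex (diamond k') + edge (diamond k') * nat =>
      match v with
      | inl w => 2 *: embed w
      | inr (e, n) => embed (side e false) + embed (side e true) + x (n :: address e)
      end
  end.

(** Subdividing keeps the difference along an edge up to sign and adds one vector deeper in the same
    branch; coefficients never exceed 1 in modulus. *)
Lemma embed_edge k (e : edge (diamond k)) :
  cube_sums (chain (address e)) (embed (side e true) - embed (side e false)).
Proof.
elim: k e => [|k IH] /= => [_|[[e n] b]].
  by exists 1; rewrite normr1 scale1r subr0 subrr.
exists 0; rewrite normr0 scale0r subr0; split => //.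
exists 1; rewrite normr1 scale1r; split => //; rewrite /side /= -!/(side e _).
have -> : embed (side e false) + embed (side e true) + x (n :: address e) -
    2 *: embed (if b then (ends e).2 else (ends e).1) - x (n :: address e) =
    (-1) ^+ b *: (embed (side e true) - embed (side e false)).
  by case: b; rewrite /side /= ?expr1 ?expr0; vector.
by apply: cube_sumsZ => //; rewrite normrX normrN normr1 expr1n.
Qed.

Lemma embed_walk (p q : vertex (diamond K)) n : walk p n q ->
  `|embed p - embed q| <= 3 / 2 * n%:R.
Proof.
elim=> [|m v w _ IH /adjacentP[e [s [vE wE]]]]; first by rewrite subrr normr0 mulr0.
have vw : `|embed v - embed w| <= 3 / 2.
  have := upper (size_address e) (embed_edge e).
  by rewrite vE wE; case: s {vE wE} => //; rewrite distrC.
have := ler_normD (embed p - embed v) (embed v - embed w).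
by rewrite addrA subrK -natr1; lra.
Qed.

Lemma embed_lipschitz (p q : vertex (diamond K)) :
  `|embed p - embed q| <= 3 / 2 * path_dist R p q.
Proof.
rewrite -ler_pdivrMl; last by lra.
apply: path_dist_ge => n pq; rewrite ler_pdivrMl; last by lra.
exact: embed_walk.
Qed.

Let coord l k (v : vertex (diamond k)) : R := g l (embed v).

Let coord_old l k (w : vertex (diamond k)) :
  coord l (inl w : vertex (diamond k.+1)) = 2 * coord l w.
Proof. by rewrite /coord /= (scalarE (gb l).1). Qed.

Let coord_new l k (e : edge (diamond k)) n : l <> n :: address e ->
  coord l (inr (e, n) : vertex (diamond k.+1)) =
    coord l (side e false) + coord l (side e true).
Proof. by move=> ln; rewrite /coord /= !(scalarE (gb l).1) gx0// addr0. Qed.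

Let coord_deep l k (v : vertex (diamond k)) : (k.*2 < size l)%N -> coord l v = 0.
Proof.
elim: k v => [|k IH].
  case=> l0; rewrite /coord /=; last by rewrite (scalarE (gb l).1).
  by rewrite gx0// => lE; move: l0; rewrite lE.
move=> [w|[e n]] lk.
  by rewrite coord_old IH ?mulr0//; apply: leq_trans lk; lia.
have kl : (k.*2 < size l)%N by apply: leq_trans lk; lia.
rewrite coord_new ?IH ?addr0// => lE.
by move: lk; rewrite lE /= size_address; lia.
Qed.

(** The coordinate at the root measures the position between the two original vertices and changes
    by one along each edge. *)
Let height k (v : vertex (diamond k)) := coord [::] v.

Definition is_sign (d : R) : Prop := d = 1 \/ d = -1.

Let height_edge k (e : edge (diamond k)) : exists2 d, is_sign d &
  height (side e true) = height (side e false) + d.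
Proof.
elim: k e => [|k IH] e.
  exists 1; first by left.
  by rewrite /height /coord /side /= (scalarE (gb _).1) add0r gx.
case: e => [[e n] b]; have [d d1 dE] := IH e.
exists (if b then - d else d).
  by case: b; case: d1 => ->; [right|left|left|right]; rewrite ?opprK.
have -> : side ((e, n, b) : edge (diamond k.+1)) false = inl (side e b) by [].
have -> : side ((e, n, b) : edge (diamond k.+1)) true = inr (e, n) by [].
rewrite /height coord_old coord_new// -!/(height _) dE.
by case: b; rewrite -/(height _) ?dE; lra.
Qed.

(** The two edges lie on opposite sides of [w] in height, so their distances to [w] add up in the
    height difference. *)
Definition vertical k (e e' : edge (diamond k)) : Prop := exists w t t' d,
  [/\ pole e w t, pole e' w t', is_sign d,
      forall s, height (side e s) = height w + d * (t s)%:R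
    & forall s, height (side e' s) = height w - d * (t' s)%:R].

(** Both edges lie on the same side of [w] in height, which only reveals [t - t']; a further
    coordinate [m] sees [t] and is blind to [e']. *)
Definition forked k (e e' : edge (diamond k)) : Prop := exists w t t' d,
  [/\ pole e w t, pole e' w t', is_sign d,
      (forall s, height (side e s) = height w + d * (t s)%:R) /\
      (forall s, height (side e' s) = height w + d * (t' s)%:R)
    & exists2 m, (size m <= k.*2)%N &
        forall s, coord m (side e s) = (t s)%:R /\ coord m (side e' s) = 0].

Let coord_lift l k (e : edge (diamond k)) n b (t : bool -> nat) (a d : R) :
  l <> n :: address e ->
  (forall s, coord l (side e s) = a + d * (t s)%:R) ->
  forall s, coord l (side ((e, n, b) : edge (diamond k.+1)) s) =
    2 * a + d * (if s then t false + t true else (t b).*2)%N%:R.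
Proof.
move=> le H [].
  by rewrite [LHS](coord_new le) !H natrD; lra.
by rewrite [LHS](coord_old l (side e b)) H -muln2 natrM; lra.
Qed.

Let old_label m k (e : edge (diamond k)) n : (size m <= k.*2)%N -> m <> n :: address e.
Proof. by move=> mk mE; move: mk; rewrite mE /= size_address ltnn. Qed.

Let vertical_lift k (e e' : edge (diamond k)) n b n' b' : vertical e e' ->
  vertical ((e, n, b) : edge (diamond k.+1)) ((e', n', b') : edge (diamond k.+1)).
Proof.
move=> [w [t [t' [d [pe pe' d1 he he']]]]].
exists (inl w), (fun s => if s then t false + t true else (t b).*2)%N.
exists (fun s => if s then t' false + t' true else (t' b').*2)%N, d.
split => //; [exact: pole_subdivide|exact: pole_subdivide| |].
  by move=> s; rewrite /height (coord_lift _ _ he)// coord_old.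
have he'' s : coord [::] (side e' s) = height w + (- d) * (t' s)%:R.
  by rewrite mulNr; exact: he'.
by move=> s; rewrite /height (coord_lift _ _ he'')// coord_old mulNr.
Qed.

Let forked_lift k (e e' : edge (diamond k)) n b n' b' : forked e e' ->
  forked ((e, n, b) : edge (diamond k.+1)) ((e', n', b') : edge (diamond k.+1)).
Proof.
move=> [w [t [t' [d [pe pe' d1 [he he'] [m mk mP]]]]]].
exists (inl w), (fun s => if s then t false + t true else (t b).*2)%N.
exists (fun s => if s then t' false + t' true else (t' b').*2)%N, d.
split => //; [exact: pole_subdivide|exact: pole_subdivide| |].
  by split=> s; rewrite /height ?(coord_lift _ _ he)// ?(coord_lift _ _ he')// coord_old.
exists m; first by apply: leq_trans mk _; lia.
have me s : coord m (side e s) = 0 + 1 * (t s)%:R by rewrite (mP s).1 mul1r add0r.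
have me' s : coord m (side e' s) = 0 + 0 * (t' s)%:R by rewrite (mP s).2 mul0r add0r.
move=> s; rewrite (coord_lift _ (@old_label m k e n mk) me).
rewrite (coord_lift _ (@old_label m k e' n' mk) me').
by rewrite !mulr0 !add0r mul1r mul0r.
Qed.

Let vertical_new k (e : edge (diamond k)) n b :
  vertical ((e, n, b) : edge (diamond k.+1)) ((e, n, ~~ b) : edge (diamond k.+1)).
Proof.
have [d d1 dE] := height_edge e.
have new_pole b' : pole (G := diamond k.+1) (e, n, b') (inr (e, n)) (fun s => (~~ s : nat)).
  split; last by right.
  by case; [exact: walk_nil|exact/walk1/adjacent_new].
exists (inr (e, n)), (fun s => ~~ s : nat), (fun s => ~~ s : nat), (if b then d else - d).
have hnew : height (inr (e, n) : vertex (diamond k.+1)) =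
    height (side e false) + height (side e true) by exact: coord_new.
have hold b' : height (inl (side e b') : vertex (diamond k.+1)) = 2 * height (side e b').
  exact: coord_old.
split => //; first by case: b; case: d1 => ->; rewrite ?opprK; [left|right|right|left].
- case; first by rewrite mulr0 addr0.
  rewrite [LHS](hold b) hnew dE; case: b; rewrite ?dE /=; lra.
- case; first by rewrite mulr0 subr0.
  rewrite [LHS](hold (~~ b)) hnew dE; case: b; rewrite ?dE /=; lra.
Qed.

Let forked_new k (e : edge (diamond k)) n b n' b' : (k < K)%N -> n <> n' ->
  forked ((e, n, b) : edge (diamond k.+1)) ((e, n', b') : edge (diamond k.+1)).
Proof.
move=> kK nn'; have [d d1 dE] := height_edge e.
have hnew i : height (inr (e, i) : vertex (diamond k.+1)) =
    height (side e false) + height (side e true) by exact: coord_new.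
have hold c : height (inl (side e c) : vertex (diamond k.+1)) = 2 * height (side e c).
  exact: coord_old.
have walk_new c i : walk (inr (e, i) : vertex (diamond k.+1)) 1 (inl (side e c)).
  exact/walk1/adjacent_sym/adjacent_new.
exists (inl (side e b)), (fun s => s : nat).
(* The old end of the second edge is [w] itself or the opposite end, two steps away through the new
   vertex [n']. *)
exists (fun s => if s then 1 else if b == b' then 0 else 2)%N, (if b then - d else d).
split => //.
- by split; [case; [exact: walk_new|exact: walk_nil]|left].
- split; last by case: eqP; [left|right].
  case; first exact: walk_new.
  case: eqP => [->|_]; first exact: walk_nil.
  exact: (@walk_trans (diamond k.+1) 1 1 _ _ _ (walk1 (adjacent_new e n' b')) (walk_new b n')).
- by case: b; case: d1 => ->; rewrite ?opprK; [right|left|left|right].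
- split; case.
  + by rewrite [LHS]hnew hold dE; case: b; rewrite ?dE /=; lra.
  + by rewrite mulr0 addr0.
  + by rewrite [LHS]hnew hold dE; case: b; rewrite ?dE /=; lra.
  + rewrite [LHS](hold b') hold; case: b; case: b'; rewrite ?dE /=; lra.
have mk : (k.*2 < size (n :: address e))%N by rewrite /= size_address.
(* This coordinate is 1 at the [n]-th new vertex of [e] and 0 at its siblings and at old
   vertices. *)
exists (n :: address e); first by rewrite /= size_address; lia.
have old0 c : coord (n :: address e) (inl (side e c) : vertex (diamond k.+1)) = 0.
  by rewrite coord_old coord_deep ?mulr0.
case; split; rewrite ?[LHS]old0//.
- have := gb (n :: address e) => -[gl _].
  rewrite /coord /= !(scalarE gl) -![g _ (embed _)]/(coord _ _).
  by rewrite !coord_deep// !add0r gx//= size_address; lia.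
- by rewrite [LHS]coord_new ?coord_deep ?addr0// => -[].
Qed.

(** Edges are compared at the subdivision that first separates them, where they become vertical or
    forked; both relations survive later subdivisions. *)
Let edge_pair k (e e' : edge (diamond k)) : (k <= K)%N ->
  [\/ e = e', vertical e e' | forked e e'].
Proof.
elim: k e e' => [|k IH] e e' kK; first by constructor 1; case: e; case: e'.
case: e => [[e n] b]; case: e' => [[e' n'] b'].
have [<-|ee'|ee'] := IH e e' (ltnW kK); last 2 first.
- by constructor 2; exact: vertical_lift.
- by constructor 3; exact: forked_lift.
have [<-|nn'] := pselect (n = n'); last by constructor 3; exact: forked_new.
have [->|bb'] := eqVneq b b'; first by constructor 1.
have -> : b' = ~~ b by case: b b' bb' => -[].
by constructor 2; exact: vertical_new.
Qed.

Let coord_dist l k (p q : vertex (diamond k)) :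
  `|coord l p - coord l q| <= 3 * `|embed p - embed q|.
Proof. by have [gl gbd] := gb l; rewrite /coord -(scalarB _ _ gl). Qed.

(** Coordinates have norm at most 3. A vertical pair gives [t + t'] directly; for a forked pair
    [t + t' <= 2 * t + |t' - t|] costs three coordinate estimates, whence 9. *)
Lemma path_dist_embed (p q : vertex (diamond K)) :
  path_dist R p q <= 9 * `|embed p - embed q|.
Proof.
have [e [s ->]] := vertex_side p; have [e' [s' ->]] := vertex_side q.
have hd := coord_dist [::] (side e s) (side e' s').
have [ee'|[w [t [t' [d [[te _] [te' _] d1 he he']]]]]|] := edge_pair e e' (leqnn K).
- move: hd; rewrite -{}ee'; have [<-|ss'] := eqVneq s s'.
    by move=> _; apply: le_trans (path_dist_le (walk_nil _)) _; rewrite mulr_ge0.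
  have -> : s' = ~~ s by case: s s' ss' => -[].
  have [d d1 dE] := height_edge e.
  have := path_dist_le (walk1 (adjacent_side e s)).
  have : `|coord [::] (side e s) - coord [::] (side e (~~ s))| = 1.
    rewrite -!/(height _); case: s {ss'}; rewrite /= dE.
      by rewrite addrC addKr; case: d1 => ->; rewrite ?normrN normr1.
    by rewrite opprD addrA subrr add0r normrN; case: d1 => ->; rewrite ?normrN normr1.
  have := normr_ge0 (embed (side e s) - embed (side e (~~ s))); lra.
- have := path_dist_le (walk_trans (te s) (walk_sym (te' s'))).
  move: hd; rewrite -!/(height _) he he' natrD.
  have -> : height w + d * (t s)%:R - (height w - d * (t' s')%:R) =
    d * ((t s)%:R + (t' s')%:R) by lra.
  have -> : `|d * ((t s)%:R + (t' s')%:R)| = (t s)%:R + (t' s')%:R.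
    have tt' : 0 <= (t s)%:R + (t' s')%:R :> R by rewrite addr_ge0.
    by rewrite normrM (ger0_norm tt'); case: d1 => ->; rewrite ?normrN normr1 mul1r.
  have := normr_ge0 (embed (side e s) - embed (side e' s')); lra.
- move=> [w [t [t' [d [[te _] [te' _] d1 [he he'] [m _ mP]]]]]].
  have := path_dist_le (walk_trans (te s) (walk_sym (te' s'))).
  have := coord_dist m (side e s) (side e' s').
  rewrite (mP s).1 (mP s').2 subr0 ger0_norm// natrD.
  move: hd; rewrite -!/(height _) he he'.
  have -> : height w + d * (t s)%:R - (height w + d * (t' s')%:R) =
    d * ((t s)%:R - (t' s')%:R) by lra.
  have -> : `|d * ((t s)%:R - (t' s')%:R)| = `|(t' s')%:R - (t s)%:R|.
    by rewrite distrC normrM; case: d1 => ->; rewrite ?normrN normr1 mul1r.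
  have := ler_norm ((t' s')%:R - (t s)%:R : R); lra.
Qed.

End embedding.
End diamond_geometry.

(** * Selecting a biorthogonal tree *)

Section biorthogonal_tree.
Variables (R : realType) (Y : completeNormedModType R).
Implicit Types (l : seq nat).

(** Dependent choice in which the condition on a term may refer to all earlier terms. *)
Lemma history_choice (T : Type) (d : T) (P : seq T -> T -> Prop) :
    (forall h, (forall j, (j < size h)%N -> P (take j h) (nth d h j)) ->
      exists y, P h y) ->
  exists u : nat -> T, forall i, P (mkseq u i) (u i).
Proof.
move=> H.
have /choice[F FP] h : exists y,
    (forall j, (j < size h)%N -> P (take j h) (nth d h j)) -> P h y.
  have [/H[y Py]|nh] := pselect (forall j, (j < size h)%N -> P (take j h) (nth d h j)).
    by exists y.
  by exists d.
pose hs n := iter n (fun h => rcons h (F h)) [::].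
have hsE n : mkseq (fun i => F (hs i)) n = hs n.
  by elim: n => // n IH; rewrite mkseqS IH.
exists (fun i => F (hs i)); elim/ltn_ind => i IH; rewrite hsE; apply: FP.
move=> j; rewrite -hsE size_mkseq => ji; rewrite nth_mkseq//.
have -> : take j (mkseq (fun i => F (hs i)) i) = mkseq (fun i => F (hs i)) j.
  by rewrite /mkseq -map_take take_iota (minn_idPl (ltnW ji)).
exact: IH.
Qed.

Local Notation code := CodeSeq.code.
Local Notation decode := CodeSeq.decode.

Lemma code_behead n l : (code l < code (n :: l))%N.
Proof.
rewrite /= -/(code l); apply: (@leq_trans (code l).*2.+1); first by lia.
by rewrite leq_pmull// expn_gt0.
Qed.

Lemma eq_chain (x x' : seq nat -> Y) l :
  (forall m, (code m <= code l)%N -> x m = x' m) -> chain x l = chain x' l.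
Proof.
elim: l => [|n l IH] H /=; first by rewrite H.
rewrite H// IH// => m ml; apply: H; apply: leq_trans ml _.
exact/ltnW/code_behead.
Qed.

Let sphere : set Y := [set x | `|x| = 1].

(* Vectors are chosen along an enumeration in which parents precede children,
   each being annihilated by the earlier functionals while its own functional
   annihilates the earlier vectors. *)
Lemma biorthogonal_tree (K : R) N : often sphere N.+1 (upper_bounded K) ->
  exists (x : seq nat -> Y) (g : seq nat -> Y -> R),
    [/\ forall l, bounded_scalar 3 (g l),
        forall l, (size l <= N)%N -> g l (x l) = 1,
        forall l m, l <> m -> g l (x m) = 0
      & forall l, size l = N -> upper_bounded K (chain x l)].
Proof.
move=> start.
pose T := (Y * (Y -> R))%type; pose d : T := (0, fun=> 0).
(* The branch [c] is listed deepest vector first and can still be continued by [j] rounds; [catrev]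
   makes a move an insertion at its head. *)
pose W j c := often sphere j (fun s => upper_bounded K (catrev s c)).
have W0 : W N.+1 [::].
  apply: oftenS start => s Ks y ys; apply: Ks.
  by rewrite -[s]revK; apply: cube_sums_rev; rewrite /rev.
pose vec (h : seq T) l := (nth d h (code l)).1.
pose P (h : seq T) (y : T) :=
  [/\ bounded_scalar 3 y.2,
      (size (decode (size h)) <= N)%N -> y.2 y.1 = 1 /\
        W (N - size (decode (size h)))%N (chain (vec (rcons h y)) (decode (size h)))
    & forall j, (j < size h)%N -> y.2 (nth d h j).1 = 0 /\ (nth d h j).2 y.1 = 0].
have [h hP|u uP] := @history_choice T d P.
  have zb : bounded_scalar 3 ((fun=> 0) : Y -> R) by apply: bounded_scalar0.
  have hb j : bounded_scalar 3 (nth d h j).2.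
    have [jh|jh] := ltnP j (size h); first by case: (hP j jh).
    by rewrite nth_default.
  case: (leqP (size (decode (size h))) N) => [lN|Nl]; last first.
    (* Nodes deeper than [N] receive the zero vector and the zero functional. *)
    exists d; split => //; first by rewrite leqNgt Nl.
    by move=> j jh; split => //=; apply: scalar0; case: (hb j).
  have [Z cZ ZP] := cof_annihilator [seq y.1 | y <- h].
  pose Z' := Z `&` [set y | forall j, j \in iota 0 (size h) -> (nth d h j).2 y = 0].
  have cZ' : cof Z'.
    apply: cofI => //; apply: (@cof_seq _ _ _ (fun j => [set y | (nth d h j).2 y = 0])) => j.
    exact: cof_ker (hb j).
  have [y [[Zy hy] y1 Wy]] : exists y, [/\ Z' y, `|y| = 1 & forall f : Y -> R,
      W (N - size (decode (size h)))%N (chain (vec (rcons h (y, f))) (decode (size h)))].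
    move lE : (decode (size h)) => l; have cl : code l = size h by rewrite -lE CodeSeq.decodeK.
    rewrite lE in lN; case: l => [|n l] in lE cl lN *.
      have [y [Z'y y1 Wy]] := W0 _ cZ'; exists y; split => // f.
      by rewrite subn0 /= /vec nth_rcons cl ltnn eqxx.
    have lh : (code l < size h)%N by rewrite -cl code_behead.
    have := hP _ lh; rewrite /P size_take lh CodeSeq.codeK => -[_ /(_ (ltnW lN))[_ Wl] _].
    have Wl' : W (N - size (n :: l)).+1 (chain (vec h) l).
      have -> : (N - size (n :: l)).+1 = (N - size l)%N by rewrite /= subnSK.
      move: Wl; congr W; apply: eq_chain => m ml; rewrite /vec.
      by rewrite -take_nth// nth_take// ltnS.
    have [y [Z'y y1 Wy]] := Wl' _ cZ'; exists y; split => // f.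
    have -> : chain (vec (rcons h (y, f))) (n :: l) = y :: chain (vec h) l.
      rewrite /= {1}/vec nth_rcons cl ltnn eqxx; congr (_ :: _).
      apply: eq_chain => m ml; rewrite /vec nth_rcons.
      by rewrite (leq_ltn_trans ml lh).
    exact: Wy.
  have [g [gb gh gy]] := ZP y Zy; have [gl _] := gb.
  have gy3 : 1 / 3 <= g y by move: gy; rewrite y1.
  have gy0 : 0 < g y by lra.
  (* Normalizing to value 1 at [y] divides by [g y >= 1 / 3], hence the norm bound 3. *)
  exists (y, fun w => (g y)^-1 * g w); split => //=.
  - have := bounded_scalar_comb (g y)^-1 0 gb gb.
    rewrite normr0 mul0r addr0 mulr1 => gb'.
    have : bounded_scalar `|(g y)^-1| (fun w => (g y)^-1 * g w).
      by move: gb'; congr bounded_scalar; apply/funext => w; rewrite mul0r addr0.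
    apply: bounded_scalarW; rewrite ger0_norm ?invr_ge0 ?(ltW gy0)//.
    by rewrite invf_ple ?posrE//; lra.
  - by move=> _; split => //; rewrite mulVf// gt_eqF.
  - move=> j jh; split; last by apply: hy; rewrite mem_iota.
    rewrite (gh (nth d h j).1) ?mulr0//; apply/(nthP (0 : Y)).
    exists j; first by rewrite size_map.
    by rewrite (nth_map d).
have nthu i j : (j < i)%N -> nth d (mkseq u i) j = u j by move=> ji; rewrite nth_mkseq.
exists (fun l => (u (code l)).1), (fun l => (u (code l)).2); split.
- by move=> l; case: (uP (code l)).
- by move=> l lN; have [_ + _] := uP (code l); rewrite size_mkseq CodeSeq.codeK => /(_ lN)[].
- move=> l m lm; have clm : code l <> code m by move=> /(can_inj CodeSeq.codeK).
  have [lt|gt|//] := ltngtP (code l) (code m).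
    by have [_ _ +] := uP (code m); rewrite size_mkseq => /(_ _ lt)[_]; rewrite nthu.
  by have [_ _ +] := uP (code l); rewrite size_mkseq => /(_ _ gt)[+ _]; rewrite nthu.
- move=> l lN; have [_ + _] := uP (code l); rewrite size_mkseq CodeSeq.codeK lN leqnn subnn.
  move=> /(_ isT)[_ /=]; congr (upper_bounded _ _); apply: eq_chain => m ml.
  by rewrite /vec -mkseqS nthu.
Qed.

End biorthogonal_tree.

Theorem diamond_distortion_le (R : realType) (Y : completeNormedModType R) k :
  reflexive_unconditional Y -> ~ auc_convexifiable Y ->
  (diamond_distortion Y k <= (27 / 2)%:E)%E.
Proof.
move=> YR nY; have [K0 /often_almost_c0 /(_ k.*2.+1) all0] := often_upper_bounded YR nY.
have [x [g [gb gx gx0 upper]]] := biorthogonal_tree all0.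
(* The lower constant is 1/9 and the upper one is [3 / 2 = 27 / 2 * (1 / 9)]. *)
apply: ereal_inf_lbound; exists (27 / 2) => //; split; first by lra.
exists (1 / 9), (@embed R Y x k); split; first by lra.
move=> p q; have := path_dist_embed gb gx gx0 p q.
by have := embed_lipschitz upper p q => H1 H2; apply/andP; split; lra.
Qed.

(** * Asymptotically uniformly convex spaces omit the diamonds *)

Section auc_obstruction.
Variables (R : realType) (Y : completeNormedModType R) (N : Y -> R).
Implicit Types (x y z : Y) (G : graph).

(** Walks project to walks of at most half the length. At a new vertex the strict inequality leaves
    room for one more step to either end. *)
Lemma walk_from_old G (u : vertex G) n (v : vertex (subdivide G)) :
  walk (inl u : vertex (subdivide G)) n v ->
  match v with
  | inl w => exists2 j, walk u j w & (j.*2 <= n)%N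
  | inr (e, _) => exists j s, walk u j (side e s) /\ (j.*2 < n)%N
  end.
Proof.
elim=> [|m v' w' _ IH [[[e i] b] [] ee]]; first by exists 0; [exact: walk_nil|].
  case: ee IH => <- <- [j uj jm]; exists j, b; split; last by lia.
  by rewrite /side.
case: ee IH => <- <- [j [s [uj jm]]].
have [->|bs] := eqVneq b s; first by exists j; [exact: uj|lia].
exists j.+1; last by lia.
apply: walk_rcons uj _; rewrite -/(side e b).
have -> : b = ~~ s by case: b s bs => -[].
exact: adjacent_side.
Qed.

Lemma path_dist_old k (u v : vertex (diamond k)) :
  2 * path_dist R u v <= path_dist R (inl u : vertex (diamond k.+1)) (inl v).
Proof.
apply: (@path_dist_ge R k.+1) => n /walk_from_old[j uv jn].
apply: (@le_trans _ _ (2 * j%:R)); first by rewrite ler_pM2l// path_dist_le.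
by rewrite -natrM ler_nat; lia.
Qed.

Lemma walkE G (u v : vertex G) n : walk u n v ->
  if n is m.+1 then exists2 w, walk u m w & adjacent w v else u = v.
Proof. by case=> // m w v'; exists w. Qed.

Lemma path_dist_siblings k (e : edge (diamond k)) m n : m <> n ->
  2 <= path_dist R (inr (e, m) : vertex (diamond k.+1)) (inr (e, n)).
Proof.
move=> mn; apply: (@path_dist_ge R k.+1) => -[|[|j]] /walkE.
- by move=> [/mn].
- by move=> [w /walkE <- [[[e' i] b] [] []]].
- by move=> _; rewrite ler_nat.
Qed.

Hypothesis N_equiv : equivalent_norm N.

Let ND x y : N (x + y) <= N x + N y.
Proof. by case: N_equiv => + _ _; apply. Qed.

Let NZ a x : N (a *: x) = `|a| * N x.
Proof. by case: N_equiv => _ + _; apply. Qed.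

Let NN x : N (- x) = N x.
Proof. by rewrite -scaleN1r NZ normrN normr1 mul1r. Qed.

Let N0 x : 0 <= N x.
Proof. exact: (@seminorm_ge0 R Y N x (conj ND NZ)). Qed.

Let NB x y : N (x - y) <= N x + N y.
Proof. by rewrite -(NN y) ND. Qed.

Hypothesis N_auc : asymptotically_uniformly_convex N.

(** Growth at distance exactly [t] from [y] extends to all [N z >= t] by convexity of [N] along the
    ray from [y]. *)
Lemma auc_modulusP (t : R) : 0 < t < 1 -> exists2 d, 0 < d &
  forall y, N y = 1 -> exists2 Z, cof Z &
    forall z, Z z -> t <= N z -> 1 + d <= N (y + z).
Proof.
move=> t01; have /andP[t0 _] := t01; have /= := N_auc t01.
set M := auc_modulus _ _ => M0.
have [d d0 dM] : exists2 d, 0 < d & (d%:E < M)%E.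
  case: M M0 => [r| |]//; last by exists 1 => //; exact: ltry.
  by rewrite lte_fin => r0; exists (r / 2); rewrite ?lte_fin; lra.
exists d => // y y1.
have : (d%:E < ereal_sup [set ereal_inf [set (N (y + t *: z)%R - 1)%R%:E |
    z in [set z | Z z /\ N z = 1%R]] | Z in cof (Y := Y)])%E.
  by apply: lt_le_trans dM _; apply: ereal_inf_lbound; exists y.
move=> /ereal_sup_gt[_ [Z cZ <-] dZ]; exists Z => // z Zz tz.
have z0 : 0 < N z by apply: lt_le_trans tz.
have : (d%:E <= (N (y + t *: ((N z)^-1 *: z))%R - 1)%R%:E)%E.
  apply: le_trans (ltW dZ) _; apply: ereal_inf_lbound.
  exists ((N z)^-1 *: z) => //; split; first exact: subspaceZ (cof_subspace cZ) Zz.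
  by rewrite NZ ger0_norm ?invr_ge0// mulVf// gt_eqF.
rewrite lee_fin => dz; pose a := t / N z.
have a01 : 0 <= a <= 1 by rewrite divr_ge0 ?(ltW t0)//= ler_pdivrMr// mul1r.
have /andP[a0 a1] := a01.
have E : y + t *: ((N z)^-1 *: z) = a *: (y + z) + (1 - a) *: y.
  by rewrite /a; vector.
have := ND (a *: (y + z)) ((1 - a) *: y); rewrite -E !NZ y1.
rewrite (ger0_norm a0) ger0_norm ?subr_ge0// => H.
have [//|lt] := lerP (1 + d) (N (y + z)).
have : a * N (y + z) <= a * (1 + d) by rewrite ler_wpM2l// ltW.
have a_pos : 0 < a by rewrite divr_gt0.
have : a * N (y + z) < a * (1 + d) by rewrite ltr_pM2l.
have : a * d <= 1 * d by rewrite ler_wpM2r// ltW.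
lra.
Qed.

(** The upper bound is asked on edges only, since it is edges of the coarser graph whose images turn
    out shorter. *)
Definition distorts k (L s : R) (f : vertex (diamond k) -> Y) : Prop :=
  (forall p q, s * path_dist R p q <= N (f p - f q)) /\
  (forall e, N (f (side e false) - f (side e true)) <= L * s).

Lemma distorts_step (L0 : R) : 1 <= L0 -> exists2 d, 0 < d &
  forall k L s (f : vertex (diamond k.+1) -> Y), L <= L0 -> 0 < s ->
    distorts L s f ->
    distorts (L / (1 + d)) (2 * s) (fun v : vertex (diamond k) => f (inl v)).
Proof.
move=> L1; have L00 : 0 < L0 by lra.
have [_ _ [c [C [c0 C0 cC]]]] := N_equiv.
(* Normalized siblings are [2 / L0] apart; an approximation error of at most [1 / L0] and halving
   leave [1 / (2 * L0)]. *)
pose t : R := 1 / (2 * L0).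
have t01 : 0 < t < 1 by rewrite divr_gt0 ?mulr_gt0//= ltr_pdivrMr ?mulr_gt0//; lra.
have [d d0 dP] := auc_modulusP t01.
exists (d / 2) => [|k L s f LL0 s0 [low up]]; first by lra.
split=> [p q|e].
  rewrite -mulrA mulrCA; apply: le_trans (low (inl p) (inl q)).
  by rewrite ler_pM2l// path_dist_old.
have [//|big] := lerP (N (f (inl (side e false)) - f (inl (side e true))))
                      (L / (1 + d / 2) * (2 * s)).
exfalso.
set a := f (inl (side e false)) in big *; set b := f (inl (side e true)) in big *.
pose m n := f (inr (e, n)).
have am n : N (a - m n) <= L * s := up (e, n, false).
have bm n : N (m n - b) <= L * s by rewrite -NN opprB; exact: (up (e, n, true)).
pose r := N (a - b) / 2.
have d20 : 0 < 1 + d / 2 by lra.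
have Ls0 : 0 <= L * s by apply: le_trans (am 0); exact: N0.
have r_big : L * s / (1 + d / 2) < r.
  have -> : L * s / (1 + d / 2) = L / (1 + d / 2) * (2 * s) / 2 by lra.
  by rewrite /r; lra.
have r0 : 0 < r by apply: le_lt_trans r_big; rewrite divr_ge0// ltW.
have rL : r <= L * s.
  have := ND (a - m 0) (m 0 - b); rewrite addrA subrK /r.
  by have := am 0; have := bm 0; lra.
(* After normalization [u] is half of the edge image and [z n] the displacement from its midpoint,
   so [u + z n] and [u - z n] have norm at most [1 + d / 2]. *)
pose u := r^-1 *: (2^-1 *: (a - b)).
pose z n := r^-1 *: (m n - 2^-1 *: (a + b)).
have Nr x : N (r^-1 *: x) = N x / r by rewrite NZ ger0_norm ?invr_ge0 ?(ltW r0)// mulrC.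
have u1 : N u = 1.
  by rewrite Nr NZ ger0_norm// [2^-1 * _]mulrC -/r divff// gt_eqF.
have near x : N x <= L * s -> N (r^-1 *: x) <= 1 + d / 2.
  move=> xL; rewrite Nr ler_pdivrMr//; apply: le_trans xL _.
  by move: r_big; rewrite ltr_pdivrMr// [r * _]mulrC => /ltW.
have um n : N (u - z n) <= 1 + d / 2.
  have -> : u - z n = r^-1 *: (a - m n) by rewrite /u /z; vector.
  exact: near (am n).
have up' n : N (u + z n) <= 1 + d / 2.
  have -> : u + z n = r^-1 *: (m n - b) by rewrite /u /z; vector.
  exact: near (bm n).
have sep n n' : n <> n' -> 2 / L0 <= N (z n - z n').
  move=> nn'; have -> : z n - z n' = r^-1 *: (m n - m n') by rewrite /z; vector.
  rewrite Nr ler_pdivlMr//; apply: le_trans (low (inr (e, n)) (inr (e, n'))).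
  apply: (@le_trans _ _ (s * 2)); last by rewrite ler_pM2l// path_dist_siblings.
  rewrite mulrAC ler_pdivrMr//; have : L * s <= L0 * s by rewrite ler_pM2r.
  lra.
have zb n : `|z n| <= (2 + d / 2) / c.
  rewrite ler_pdivlMr// mulrC; have /andP[+ _] := cC (z n) => /le_trans; apply.
  have := NB (u + z n) u; rewrite addrAC subrr add0r u1; have := up' n; lra.
have [Z cZ ZP] := dP u u1.
pose ep := Num.min (d / 2) L0^-1 / C.
have ep0 : 0 < ep by rewrite divr_gt0// lt_min divr_gt0//= invr_gt0.
have Cep : C * ep = Num.min (d / 2) L0^-1 by rewrite mulrC divfK// gt_eqF.
have Cd : C * ep <= d / 2 by rewrite Cep ge_min lexx.
have CL : C * ep <= L0^-1 by rewrite Cep ge_min lexx orbT.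
have [i [j [ij [w Zw zw]]]] := cof_near cZ ep0 zb.
have Nzw : N (z i - z j - w) <= C * ep.
  by have /andP[_ /le_trans] := cC (z i - z j - w); apply; rewrite ler_pM2l.
have tw : t <= N (2^-1 *: w).
  rewrite NZ ger0_norm//; have := sep i j ij.
  have := ND w (z i - z j - w); rewrite addrC subrK.
  have -> : t = L0^-1 / 2 by rewrite /t div1r invfM mulrC.
  lra.
have := ZP _ (subspaceZ _ (cof_subspace cZ) Zw) tw.
(* An average of two vectors of norm at most [1 + d / 2], up to an error of norm at most [d / 4]:
   too short for the growth [1 + d]. *)
have -> : u + 2^-1 *: w = 2^-1 *: ((u + z i) + (u - z j)) -
    2^-1 *: (z i - z j - w) by vector.
have := NB (2^-1 *: ((u + z i) + (u - z j))) (2^-1 *: (z i - z j - w)).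
rewrite !NZ ger0_norm//; have := ND (u + z i) (u - z j).
have := up' i; have := um j; lra.
Qed.

(** Each of the [k] coarsenings divides the constant by [1 + d], and on the single edge it is still
    at least 1. *)
Lemma distorts_bounded (L0 d : R) k L s (f : vertex (diamond k) -> Y) :
  0 < d -> 1 <= L0 ->
  (forall k L s (f : vertex (diamond k.+1) -> Y), L <= L0 -> 0 < s ->
    distorts L s f ->
    distorts (L / (1 + d)) (2 * s) (fun v : vertex (diamond k) => f (inl v))) ->
  0 < s -> L <= L0 -> distorts L s f -> (1 + d) ^+ k <= L.
Proof.
move=> d0 L1 step; have d1 : 0 < 1 + d by lra.
elim: k L s f => [|k IH] L s f s0 LL0 fd.
  have [low up] := fd; have := le_trans (low false true) (up tt).
  rewrite expr0 mulrC ler_pM2r//; apply: le_trans.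
  by apply: (@path_dist_ge R 0) => -[/walkE//|n _]; rewrite ler1n.
rewrite exprSr -ler_pdivlMr//; apply: IH (step _ _ _ _ LL0 s0 fd).
  by rewrite mulr_gt0.
by rewrite ler_pdivrMr// (le_trans LL0)// ler_peMr//; lra.
Qed.

End auc_obstruction.

Theorem auc_sup_diamond_distortion (R : realType) (Y : completeNormedModType R) :
  auc_convexifiable Y -> sup_diamond_distortion Y = +oo%E.
Proof.
move=> [N Neq Nauc]; have [_ _ [c [C [c0 C0 cC]]]] := Neq.
apply: contrapT => fin.
have [D D1 DP] : exists2 D : R, 1 <= D & forall k, (diamond_distortion Y k < D%:E)%E.
  have le_sup k : (diamond_distortion Y k <= sup_diamond_distortion Y)%E.
    by apply: ereal_sup_ubound; exists k.
  case: (sup_diamond_distortion Y) fin le_sup => [r| |]// _ le_sup.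
    exists (Num.max 1 (r + 1)) => [|k]; first by rewrite le_max lexx.
    by apply: le_lt_trans (le_sup k) _; rewrite lte_fin lt_max ltrDl ltr01 orbT.
  by exists 1 => // k; apply: le_lt_trans (le_sup k) _; exact: ltNyr.
have DC0 : 0 < D * C / c by rewrite divr_gt0// mulr_gt0//; lra.
pose L0 := D * C / c + 1; have L1 : 1 <= L0 by rewrite /L0; lra.
have [d d0 step] := distorts_step Neq Nauc L1.
(* By Bernoulli's inequality [(1 + d) ^+ k.+1] exceeds [L0] for this [k]. *)
pose k := Num.truncn (L0 / d); have := truncnS_gt (L0 / d); rewrite -/k => kL.
have /ereal_inf_lt[_ [D' [D'1 [s [f [s0 fP]]]] <-]] := DP k.+1.
rewrite lte_fin => D'D.
have fd : distorts N (D * C / c) (c * s) f.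
  split=> [p q|e].
    have /andP[+ _] := cC (f p - f q); apply: le_trans; rewrite -mulrA ler_pM2l//.
    by case/andP: (fP p q).
  have /andP[_ +] := cC (f (side e false) - f (side e true)) => /le_trans; apply.
  have -> : D * C / c * (c * s) = C * (D * s).
    by rewrite mulrA divfK ?gt_eqF//; lra.
  rewrite ler_pM2l//; have /andP[_ +] := fP (side e false) (side e true).
  move=> /le_trans; apply.
  have D's : 0 <= D' * s by rewrite mulr_ge0 ?(ltW s0)//; lra.
  have := path_dist_le R (walk1 (adjacent_side e false)); rewrite /= => pd1.
  apply: (@le_trans _ _ (D' * s * 1)); first by rewrite ler_wpM2l.
  by rewrite mulr1 ler_pM2r// ltW.
have LL0 : D * C / c <= L0 by rewrite /L0; lra.
have := distorts_bounded d0 L1 step (mulr_gt0 c0 s0) LL0 fd.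
have := bernoulli k.+1 (ltW d0).
by move: kL; rewrite ltr_pdivrMr// => kL bern pow; lra.
Qed.

(** * The characterization and its uniformity *)

Local Open Scope ereal_scope.

Theorem corollary5p3 (R : realType) :
  (forall Y : completeNormedModType R, reflexive_unconditional Y ->
     (auc_convexifiable Y <-> sup_diamond_distortion Y = +oo)) /\
  ((forall Y : completeNormedModType R, reflexive_unconditional Y ->
      auc_convexifiable Y -> sup_diamond_distortion Y = +oo) /\
   ereal_sup [set c | exists Y : completeNormedModType R,
     [/\ reflexive_unconditional Y, ~ auc_convexifiable Y
       & c = sup_diamond_distortion Y]] < +oo).
Proof.
(* One bound for all spaces gives the uniformity and, being finite, the converse direction of the
   equivalence. *)
have bounded (Y : completeNormedModType R) : reflexive_unconditional Y ->
    ~ auc_convexifiable Y -> sup_diamond_distortion Y <= (27 / 2)%:E.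
  by move=> YR nY; apply/ereal_supP => _ [k _ <-]; exact: diamond_distortion_le.
split; last split.
- move=> Y YR; split; first exact: auc_sup_diamond_distortion.
  by move=> supY; apply: contrapT => /(bounded Y YR); rewrite supY leye_eq.
- by move=> Y _; exact: auc_sup_diamond_distortion.
- apply: (@le_lt_trans _ _ (27 / 2)%:E); last exact: ltry.
  by apply/ereal_supP => _ [Y [YR nY ->]]; exact: bounded.
Qed.
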